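(* Let $X$ be a real-valued infinitely divisible random variable, $X\sim IDD(\beta,\sigma^2,\nu)$, and suppose that its characteristic function $\phi_X(z)=\mathbb{E}(e^{izX})$ is differentiable on $\mathbb{R}$. Then, for every $g\in\mathcal{S}(\mathbb{R})$, $$\mathbb{E}\left((X-\beta)g(X)-\sigma^{2}g'(X)-\int_{\mathbb{R}}u\left(g(X+u)-g(X)\mathbf{1}_{\{|u|\leq 1\}}(u)\right)\nu(du)\right)=0.$$
   Context: $X\sim IDD(\beta,\sigma^2,\nu)$ means that $\mathbb{E}(e^{izX})=e^{\eta(z)}$ for all $z\in\mathbb{R}$, where $$\eta(z)=i\beta z-\frac{\sigma^2z^2}{2}+\int_{\mathbb{R}}\left(e^{iuz}-1-iuz\mathbf{1}_{\{|u|\le 1\}}(u)\right)\nu(du),$$ with $\beta\in\mathbb{R}$, $\sigma\ge 0$, and $\nu$ a Lévy measure on $\mathbb{R}\setminus\{0\}$, i.e. $\int_{\mathbb{R}}(1\wedge u^2)\,\nu(du)<\infty$. $\mathcal{S}(\mathbb{R})$ is the Schwartz space on $\mathbb{R}$. *)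

(* Defs.v *)
From HB Require Import structures.
From mathcomp Require Import all_boot all_order all_algebra.
From mathcomp Require Import all_classical all_reals all_analysis.
From mathcomp Require Import complex.

Set Implicit Arguments.
Unset Strict Implicit.
Unset Printing Implicit Defensive.

Import Order.TTheory GRing.Theory Num.Theory.
Import numFieldNormedType.Exports.

Local Open Scope classical_set_scope.
Local Open Scope ring_scope.
Local Open Scope complex_scope.

(* [R[i]] carries no topology or measure theory over [R] in the libraries used
   here, so exponential, derivative and Lebesgue integral of complex-valued
   functions are taken componentwise. *)

Definition cexp (R : realType) (z : R[i]) : R[i] :=
  (expR (complex.Re z))%:C * (cos (complex.Im z) +i* sin (complex.Im z)).

Definition cderivable (R : realType) (f : R -> R[i]) (x : R) : Prop :=
  derivable (fun t => complex.Re (f t)) x 1 /\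
  derivable (fun t => complex.Im (f t)) x 1.

Definition cderive1 (R : realType) (f : R -> R[i]) (x : R) : R[i] :=
  derive1 (fun t => complex.Re (f t)) x +i* derive1 (fun t => complex.Im (f t)) x.

Definition cintegrable d (T : measurableType d) (R : realType)
    (mu : {measure set T -> \bar R}) (f : T -> R[i]) : Prop :=
  mu.-integrable setT (fun t => (complex.Re (f t))%:E) /\
  mu.-integrable setT (fun t => (complex.Im (f t))%:E).

Definition cintegral d (T : measurableType d) (R : realType)
    (mu : {measure set T -> \bar R}) (f : T -> R[i]) : R[i] :=
  (\int[mu]_t complex.Re (f t)) +i* (\int[mu]_t complex.Im (f t)).

Definition schwartz (R : realType) (g : R -> R[i]) : Prop :=
  (forall (n : nat) (x : R), cderivable (iter n (@cderive1 R) g) x) /\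
  (forall m n : nat, exists M : R, forall x : R,
     ComplexField.Normc.normc (x%:C ^+ m * iter n (@cderive1 R) g x) <= M).

(* A measure on R \ {0} is a Borel measure on R that does not charge {0}. *)
Definition levy_measure (R : realType)
    (nu : {measure set (measurableTypeR R) -> \bar R}) : Prop :=
  nu [set 0] = 0%E /\ (\int[nu]_u (Num.min 1 (u ^+ 2))%:E < +oo)%E.

Definition char_fun d (T : measurableType d) (R : realType)
    (P : probability T R) (X : {RV P >-> R}) (z : R) : R[i] :=
  cintegral P (fun w => cexp ('i%C * (z * X w)%:C)).

Definition small_jump (R : realType) : set R := [set u | `|u| <= 1].

Definition levy_exponent (R : realType) (beta sigma : R)
    (nu : {measure set (measurableTypeR R) -> \bar R}) (z : R) : R[i] :=
  'i%C * (beta * z)%:C - (sigma ^+ 2 * z ^+ 2 / 2)%:C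
  + cintegral nu (fun u : R => cexp ('i%C * (u * z)%:C) - 1
                    - 'i%C * (u * z * \1_(@small_jump R) u)%:C).

Definition IDD d (T : measurableType d) (R : realType)
    (P : probability T R) (X : {RV P >-> R}) (beta sigma : R)
    (nu : {measure set (measurableTypeR R) -> \bar R}) : Prop :=
  forall z : R, char_fun X z = cexp (levy_exponent beta sigma nu z).

Definition jump_integrand (R : realType) (g : R -> R[i]) (x u : R) : R[i] :=
  u%:C * (g (x + u) - g x * (\1_(@small_jump R) u)%:C).

Definition stein_op (R : realType) (beta sigma : R)
    (nu : {measure set (measurableTypeR R) -> \bar R})
    (g : R -> R[i]) (x : R) : R[i] :=
  (x - beta)%:C * g x - (sigma ^+ 2)%:C * cderive1 g x
  - cintegral nu (jump_integrand g x).

(* Main.v *)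
Require Import Defs.
From HB Require Import structures.
From mathcomp Require Import all_boot all_order all_algebra.
From mathcomp Require Import all_classical all_reals all_analysis.
From mathcomp Require Import measurable_realfun complex ring lra.
Set Implicit Arguments.
Unset Strict Implicit.
Unset Printing Implicit Defensive.
Import Order.TTheory GRing.Theory Num.Theory.
Import numFieldNormedType.Exports.
Local Open Scope classical_set_scope.
Local Open Scope ring_scope.
Local Open Scope complex_scope.

(** Write A and B for the real and imaginary parts of the exponent eta, so that
    the characteristic function is phi = exp(A + iB).  Formally, the relation
    phi' = eta' phi says that the functional L(g) = E[stein_op g X] vanishes on
    every wave x |-> cos(z x - k), and a test function is a superposition of
    waves.  This makes no sense as it stands: X and the large jumps need not
    have a first moment, so L is not defined on waves and eta' is not an
    absolutely convergent integral.  The proof goes around this as follows.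

    The derivative in z is replaced by a symmetric difference quotient.  In
    terms of L, the factors x and u become sin(h x)/h and sin(h u)/h
    ([stein_step] with [sin_step h]).  These are bounded, so the stepped
    functional L_h is defined on waves, and its value there is exactly
    e^A/(2h) times a difference of two second-order Taylor remainders of
    (a, b) |-> e^a sin(t + b), taken at the increments of (A, B) over the steps
    h and -h ([expect_stein_wave]).  So L_h tends to 0 on waves, uniformly for
    bounded frequencies, as soon as these increments are o(sqrt h).

    Differentiability of phi enters through one fact.  Since A = ln |phi| is
    differentiable and has a maximum at 0, A(h) = o(h), hence the integral of
    1 - cos(h u) against nu is o(h) ([levy_osc_little_o]).  This is used twice.
    First, by Cauchy-Schwarz the large jumps contribute o(sqrt h) to the
    increments of (A, B), while the small jumps contribute O(h)
    ([levy_increment_le]).  Second, averaging 1 - cos(h u) over h in [0, t]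
    shows that nu(|u| > r) = O(1/r) ([far_jump_tail]), and this makes the jump
    integral of g bounded in x as soon as g(x) and x g(x) are bounded and g is
    Lipschitz ([jump_int_le]).  Dominated convergence as h -> 0 then gives
    L(g) = 0 for every such g which is a superposition of waves of bounded
    frequency ([stein_superpose_eq0]).

    The Fejer means of a test function, that is its averages against the
    rescaled kernel (1 - cos s)/s^2, are such superpositions ([mollifyE]): the
    kernel is the cosine transform of a compactly supported function.  They
    satisfy the required bounds uniformly, and they tend, with their
    derivatives, to a positive multiple of the test function and of its
    derivative.  A last dominated convergence gives [stein_identity_real], which
    is applied to the real and to the imaginary part of the test function. *)

(** * Real-valued integrals and Fubini's theorem *)

Section real_integrals.
Context (R : realType) (d : measure_display) (T : measurableType d)
        (mu : {measure set T -> \bar R}).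
Implicit Types f g : T -> R.

Lemma integrable_dominated f g : measurable_fun setT f ->
  mu.-integrable setT (EFin \o g) -> (forall x, `|f x| <= g x) ->
  mu.-integrable setT (EFin \o f).
Proof.
move=> mf ig fg; apply: le_integrable ig => //; first exact/measurable_EFinP.
by move=> x _ /=; rewrite lee_fin (le_trans (fg x))// ler_norm.
Qed.

Lemma integrable_measurable f : mu.-integrable setT (EFin \o f) ->
  measurable_fun setT f.
Proof. by move=> /(measurable_int mu) /measurable_EFinP. Qed.

Lemma integrableZ f (r : R) : mu.-integrable setT (EFin \o f) ->
  mu.-integrable setT (EFin \o (fun x => r * f x)).
Proof. by move=> fi; apply: (integrableZl measurableT r fi). Qed.

Lemma integrableD_real f g : mu.-integrable setT (EFin \o f) ->
  mu.-integrable setT (EFin \o g) ->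
  mu.-integrable setT (EFin \o (fun x => f x + g x)).
Proof. by move=> fi gi; apply: (integrableD measurableT fi gi). Qed.

Lemma integrableB_real f g : mu.-integrable setT (EFin \o f) ->
  mu.-integrable setT (EFin \o g) ->
  mu.-integrable setT (EFin \o (fun x => f x - g x)).
Proof. by move=> fi gi; apply: (integrableB measurableT fi gi). Qed.

Lemma eq_RintegralT f g : (forall x, f x = g x) ->
  \int[mu]_x f x = \int[mu]_x g x.
Proof. by move=> fg; apply: eq_Rintegral => x _. Qed.

Lemma Rintegral_norm_le f g : measurable_fun setT f ->
  mu.-integrable setT (EFin \o g) -> (forall x, `|f x| <= g x) ->
  `|\int[mu]_x f x| <= \int[mu]_x g x.
Proof.
move=> mf ig fg; have fi := integrable_dominated mf ig fg.
apply: le_trans (le_normr_Rintegral measurableT fi) _.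
apply: le_Rintegral => //.
by apply: (integrable_dominated _ ig) => [|x]; rewrite ?normr_id//;
  exact: measurableT_comp.
Qed.

Lemma Rintegral_dominated_cvg (f_ : nat -> T -> R) f g :
  (forall n, measurable_fun setT (f_ n)) -> measurable_fun setT f ->
  mu.-integrable setT (EFin \o g) -> (forall n x, `|f_ n x| <= g x) ->
  (forall x, f_ n x @[n --> \oo] --> f x) ->
  \int[mu]_x f_ n x @[n --> \oo] --> \int[mu]_x f x.
Proof.
move=> mf_ mf ig fg cf.
have fi : forall n, mu.-integrable setT (EFin \o f_ n).
  by move=> n; exact: integrable_dominated (fg n).
have [] := @dominated_convergence _ _ _ mu setT measurableT
  (fun n => EFin \o f_ n) (EFin \o f) (EFin \o g).
- by move=> n; exact/measurable_EFinP.
- exact/measurable_EFinP.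
- by apply: aeW => x _; apply: cvg_EFin (cf x); exact: nearW.
- exact: ig.
- by apply: aeW => x n _ /=; rewrite lee_fin.
move=> iF _ h; apply: fine_cvg; rewrite fineK //.
exact: integrable_fin_num.
Qed.

End real_integrals.

Section real_fubini.
Context (R : realType) (d1 d2 : measure_display) (T1 : measurableType d1)
        (T2 : measurableType d2)
        (m1 : {sigma_finite_measure set T1 -> \bar R})
        (m2 : {sigma_finite_measure set T2 -> \bar R})
        (f : T1 * T2 -> R) (a : T1 -> R) (b : T2 -> R).
Hypothesis mf : measurable_fun setT f.
Hypothesis ai : m1.-integrable setT (EFin \o a).
Hypothesis bi : m2.-integrable setT (EFin \o b).
Hypothesis fab : forall x y, `|f (x, y)| <= a x * b y.

Let prod_integrable : (m1 \x m2)%E.-integrable setT (EFin \o f).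
Proof.
apply/integrable12ltyP; first exact/measurable_EFinP.
have ma : measurable_fun setT a by exact: integrable_measurable ai.
have mb : measurable_fun setT b by exact: integrable_measurable bi.
apply: (@le_lt_trans _ _ (\int[m1]_x (`|a x|%:E * \int[m2]_y `|b y|%:E))%E).
  apply: ge0_le_integral => //.
  - by move=> x _; exact: integral_ge0.
  - apply: (measurable_fun_fubini_tonelli_F (fun z => `|(EFin \o f) z|)%E) => //.
    by apply: measurableT_comp => //; exact/measurable_EFinP.
  - apply: emeasurable_funM => //; apply/measurable_EFinP.
    exact: measurableT_comp.
  - move=> x _.
    rewrite -ge0_integralZl//; first last.
    + by apply/measurable_EFinP; exact: measurableT_comp.
    apply: ge0_le_integral => //.
    + apply/measurable_EFinP/measurableT_comp => //.
      exact: measurableT_comp mf (measurable_pair1 x).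
    + apply: emeasurable_funM => //; apply/measurable_EFinP.
      exact: measurableT_comp.
    + move=> y _ /=; rewrite -EFinM lee_fin (le_trans (fab x y))//.
      by rewrite -normrM ler_norm.
have bfin : (\int[m2]_y `|b y|%:E \is a fin_num)%E.
  by rewrite ge0_fin_numE ?integral_ge0//; move: bi => /integrableP[].
rewrite -(fineK bfin).
rewrite ge0_integralZr//; first last.
- by rewrite fineK// integral_ge0.
- by apply/measurable_EFinP; exact: measurableT_comp.
rewrite fineK//; apply: lte_mul_pinfty => //.
- exact: integral_ge0.
- rewrite ge0_fin_numE ?integral_ge0//; move: ai => /integrableP[_].
  by [].
- by move: bi => /integrableP[].
Qed.

Lemma integrable_section1 x : m2.-integrable setT (EFin \o (fun y => f (x, y))).
Proof.
apply: (@integrable_dominated _ _ _ _ _ (fun y => a x * b y)) => //.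
- exact: measurableT_comp mf (measurable_pair1 x).
- exact: integrableZ.
Qed.

Lemma integrable_section2 y : m1.-integrable setT (EFin \o (fun x => f (x, y))).
Proof.
apply: (@integrable_dominated _ _ _ _ _ (fun x => b y * a x)) => //.
- exact: measurableT_comp mf (measurable_pair2 y).
- exact: integrableZ.
- by move=> x; rewrite mulrC.
Qed.

Lemma integrable_Rintegral1 :
  m1.-integrable setT (EFin \o (fun x => \int[m2]_y f (x, y))).
Proof.
have := integrable_fubini_F prod_integrable.
apply: eq_integrable => // x _ /=; rewrite /fubini_F /Rintegral fineK//.
exact: integrable_fin_num (integrable_section1 x).
Qed.

Lemma integrable_Rintegral2 :
  m2.-integrable setT (EFin \o (fun y => \int[m1]_x f (x, y))).
Proof.
have mG := measurable_fubini_G prod_integrable.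
apply: (@integrable_dominated _ _ _ _ _
  (fun y => (\int[m1]_x `|a x|) * `|b y|)).
- apply/measurable_EFinP; apply: eq_measurable_fun mG => y _ /=.
  rewrite /fubini_G /Rintegral fineK//.
  exact: integrable_fin_num (integrable_section2 y).
- apply: integrableZ; apply: integrable_dominated (integrable_abse bi) _ => //=.
    by apply: measurableT_comp => //; exact: integrable_measurable bi.
  by move=> x; rewrite normr_id.
- move=> y; rewrite -RintegralZr//; last exact: integrable_abse ai.
  apply: Rintegral_norm_le.
  + exact: measurableT_comp mf (measurable_pair2 y).
  + have := integrableZ `|b y| (integrable_abse ai).
    by apply: eq_integrable => // x _ /=; rewrite mulrC.
  + by move=> x; rewrite -normrM (le_trans (fab x y))// ler_norm.
Qed.

Lemma Rintegral_fubini :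
  \int[m1]_x \int[m2]_y f (x, y) = \int[m2]_y \int[m1]_x f (x, y).
Proof.
congr fine; transitivity (\int[m1]_x \int[m2]_y (EFin \o f) (x, y))%E.
  apply: eq_integral => x _; rewrite /Rintegral fineK//.
  exact: integrable_fin_num (integrable_section1 x).
rewrite Fubini//; apply: eq_integral => y _; rewrite /Rintegral fineK//.
exact: integrable_fin_num (integrable_section2 y).
Qed.

Lemma Rintegral_prod :
  \int[(m1 \x m2)%E]_z f z = \int[m1]_x \int[m2]_y f (x, y).
Proof.
congr fine; rewrite -(integral12_prod_meas1 prod_integrable).
apply: eq_integral => x _; rewrite /fubini_F /Rintegral fineK//.
exact: integrable_fin_num (integrable_section1 x).
Qed.

Lemma integrable_prod : (m1 \x m2)%E.-integrable setT (EFin \o f).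
Proof. exact: prod_integrable. Qed.

End real_fubini.

(** * Inequalities for sine, cosine and the exponential *)

Section elementary_inequalities.
Context (R : realType).
Implicit Types x y a b t : R.

Lemma sin_lipschitz0 x : `|sin x| <= `|x|.
Proof.
wlog x0 : x / 0 < x.
  move=> H; have [x0|x0|->] := ltgtP x 0; last by rewrite sin0.
    by rewrite -[x]opprK sinN normrN [leRHS]normrN H// oppr_gt0.
  exact: H.
have [c _] := @MVT R sin cos 0 x x0 (fun y _ => is_derive_sin y)
  (continuous_subspaceT (@continuous_sin R)).
by rewrite sin0 !subr0 => ->; rewrite normrM ler_piMl// cos_max.
Qed.

Lemma sin_subE x y : sin x - sin y = 2 * cos ((x + y) / 2) * sin ((x - y) / 2).
Proof.
have -> : sin x - sin y =
    sin ((x + y) / 2 + (x - y) / 2) - sin ((x + y) / 2 - (x - y) / 2).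
  by congr (sin _ - sin _); lra.
by rewrite sinD sinB; ring.
Qed.

Lemma cos_subE x y :
  cos x - cos y = - (2 * sin ((x + y) / 2) * sin ((x - y) / 2)).
Proof.
have -> : cos x - cos y =
    cos ((x + y) / 2 + (x - y) / 2) - cos ((x + y) / 2 - (x - y) / 2).
  by congr (cos _ - cos _); lra.
by rewrite cosD cosB; ring.
Qed.

Lemma normr_half x : `|x / 2| = `|x| / 2.
Proof. by rewrite normrM (@ger0_norm _ 2^-1)// invr_ge0. Qed.

Lemma cos_lipschitz x y : `|cos x - cos y| <= `|x - y|.
Proof.
rewrite cos_subE normrN !normrM (@ger0_norm _ 2)//.
have := sin_lipschitz0 ((x - y) / 2); rewrite normr_half.
have := sin_max ((x + y) / 2).
have := normr_ge0 (sin ((x - y) / 2)); have := normr_ge0 (sin ((x + y) / 2)).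
by nra.
Qed.

Lemma onem_cosE x : 1 - cos x = 2 * sin (x / 2) ^+ 2.
Proof. by rewrite -{1}cos0 cos_subE add0r sub0r mulNr sinN; ring. Qed.

Lemma onem_cos_le x : 1 - cos x <= x ^+ 2.
Proof.
rewrite onem_cosE.
have := sin_lipschitz0 (x / 2); rewrite normr_half.
rewrite -(real_normK (num_real x)) -(real_normK (num_real (sin _))).
have := normr_ge0 (sin (x / 2)).
by nra.
Qed.

(** The mean value theorem gives |x| |cos c - 1| with c between 0 and x, and
    cosine is 1-Lipschitz. *)
Lemma sin_sub_id_le x : `|sin x - x| <= x ^+ 2.
Proof.
wlog x0 : x / 0 < x.
  move=> H; have [x0|x0|->] := ltgtP x 0.
  - by rewrite -[x]opprK sinN -opprD normrN sqrrN H// oppr_gt0.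
  - exact: H.
  - by rewrite sin0 subr0 normr0 expr2 mulr0.
have dF y : y \in `]0, x[ -> is_derive y 1 (fun z => sin z - z) (cos y - 1).
  by move=> _; apply: is_deriveB.
have [|c] := MVT x0 dF.
  apply: continuous_subspaceT => z; apply: cvgB => //; exact: continuous_sin.
rewrite in_itv/= => /andP[c0 cx]; rewrite sin0 !subr0 => ->.
rewrite normrM expr2 (gtr0_norm x0) ler_pM2r//.
rewrite -cos0; apply: le_trans (cos_lipschitz _ _) _.
by rewrite subr0 gtr0_norm// ltW.
Qed.

(** The upper bound comes from e^(-a) >= 1 - a, that is e^a (1 - a) <= 1. *)
Lemma expR_taylor1 a : `|a| <= 1 / 2 -> `|expR a - 1 - a| <= 2 * a ^+ 2.
Proof.
rewrite ler_norml => /andP[a1 a2].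
have h1 := expR_ge1Dx a; have h2 := expR_ge1Dx (- a).
have e0 := expR_gt0 a.
have h3 : expR a * (1 - a) <= 1.
  rewrite -[leRHS](expRxMexpNx_1 a) ler_pM2l//.
rewrite ger0_norm; last lra.
have : (expR a - 1 - a - 2 * a ^+ 2) * (1 - a) <= 0 by nra.
by nra.
Qed.

(** Remainder of order two at (0, 0) of the function (a, b) |-> e^a sin(t + b). *)
Definition exp_sin_remainder a b t : R :=
  expR a * sin (t + b) - sin t - (b * cos t + a * sin t).

(** Expanding sin(t + b), the remainder is a combination, with coefficients sin t
    and cos t, of e^a - 1 - a, e^a (1 - cos b), (e^a - 1) sin b and sin b - b,
    all of order two. *)
Lemma exp_sin_remainder_le a b t : `|a| <= 1 / 2 ->
  `|exp_sin_remainder a b t| <= 3 * (a ^+ 2 + b ^+ 2).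
Proof.
move=> a12; rewrite /exp_sin_remainder; have e1 := expR_taylor1 a12.
have e2 : `|expR a - 1| <= 2 * `|a|.
  have -> : expR a - 1 = (expR a - 1 - a) + a by ring.
  apply: le_trans (ler_normD _ _) _; move: e1 a12.
  by rewrite -(real_normK (num_real a)); have := normr_ge0 a; nra.
have e3 : expR a <= 2.
  have := ler_norm (expR a - 1); lra.
have e0 := expR_gt0 a.
have b1 : `|1 - cos b| <= b ^+ 2.
  by rewrite ger0_norm ?subr_ge0 ?cos_le1// onem_cos_le.
have b2 := sin_sub_id_le b.
have b3 : `|1 - cos b| <= b ^+ 2 / 2.
  rewrite onem_cosE ger0_norm; last by rewrite mulr_ge0// sqr_ge0.
  have := sin_lipschitz0 (b / 2); rewrite normr_half.
  rewrite -(real_normK (num_real b)) -(real_normK (num_real (sin _))).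
  have := normr_ge0 (sin (b / 2)); have := normr_ge0 b.
  by nra.
have -> : expR a * sin (t + b) - sin t - (b * cos t + a * sin t) =
  sin t * ((expR a - 1 - a) - expR a * (1 - cos b)) +
  cos t * ((expR a - 1) * sin b + (sin b - b)) by rewrite sinD; ring.
have s1 := sin_max t; have c1 := cos_max t.
apply: le_trans (ler_normD _ _) _; rewrite !normrM.
set u := `|_ - _|; set v := `|_ + _|.
have hu : u <= 2 * a ^+ 2 + b ^+ 2.
  apply: le_trans (ler_normB _ _) _; rewrite normrM (gtr0_norm e0).
  have := normr_ge0 (1 - cos b); nra.
have hv : v <= a ^+ 2 + 2 * b ^+ 2.
  apply: le_trans (ler_normD _ _) _; rewrite normrM.
  have := sin_lipschitz0 b.
  have h : 2 * (`|a| * `|b|) <= a ^+ 2 + b ^+ 2.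
    rewrite -(real_normK (num_real a)) -(real_normK (num_real b)).
    have := sqr_ge0 (`|a| - `|b|); nra.
  have := normr_ge0 a; have := normr_ge0 b; have := normr_ge0 (sin b).
  have := normr_ge0 (expR a - 1); nra.
have : `|sin t| * u <= u by rewrite ler_piMl// /u.
have : `|cos t| * v <= v by rewrite ler_piMl// /v.
lra.
Qed.

End elementary_inequalities.

(** * Measurability of explicit formulas *)

Section measurability.
Context (R : realType) (d : measure_display) (T : measurableType d).
Implicit Types f g : T -> R.

Lemma measurable_cst_real (r : R) : measurable_fun setT (fun _ : T => r).
Proof. exact: measurable_cst. Qed.

Lemma measurable_add f g : measurable_fun setT f -> measurable_fun setT g ->
  measurable_fun setT (fun x => f x + g x).
Proof. exact: measurable_funD. Qed.

Lemma measurable_opp f : measurable_fun setT f ->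
  measurable_fun setT (fun x => - f x).
Proof. by move=> mf; exact: (measurableT_comp (@oppr_measurable R setT)). Qed.

Lemma measurable_mul f g : measurable_fun setT f -> measurable_fun setT g ->
  measurable_fun setT (fun x => f x * g x).
Proof. exact: measurable_funM. Qed.

Lemma measurable_pow f n : measurable_fun setT f ->
  measurable_fun setT (fun x => f x ^+ n).
Proof. exact: measurable_funX. Qed.

Lemma measurable_continuous_comp (h : R -> R) f : continuous h ->
  measurable_fun setT f -> measurable_fun setT (fun x => h (f x)).
Proof.
by move=> ch mf; exact: (measurableT_comp (continuous_measurable_fun ch)).
Qed.

Lemma measurable_sin_comp f : measurable_fun setT f ->
  measurable_fun setT (fun x => sin (f x)).
Proof. exact: measurable_continuous_comp (@continuous_sin R). Qed.

Lemma measurable_cos_comp f : measurable_fun setT f ->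
  measurable_fun setT (fun x => cos (f x)).
Proof. exact: measurable_continuous_comp (@continuous_cos R). Qed.

Lemma measurable_norm_comp f : measurable_fun setT f ->
  measurable_fun setT (fun x => `|f x|).
Proof. by move=> mf; exact: (measurableT_comp (@normr_measurable R setT)). Qed.

Lemma measurable_min_comp f g : measurable_fun setT f -> measurable_fun setT g ->
  measurable_fun setT (fun x => Num.min (f x) (g x)).
Proof. exact: measurable_minr. Qed.

Lemma measurable_natr_le f g : measurable_fun setT f -> measurable_fun setT g ->
  measurable_fun setT (fun x => (f x <= g x)%R%:R : R).
Proof.
move=> mf mg.
have mb : measurable_fun setT (fun x => f x <= g x) by exact: measurable_fun_ler.
rewrite [X in measurable_fun _ X](_ : _ = (fun x => if f x <= g x then 1 else 0)).
  by apply: measurable_fun_ifT => //; exact: measurable_cst.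
by apply/funext => x; case: ifP.
Qed.

End measurability.

Section measurable_small_jump.
Context (R : realType) (d : measure_display) (T : measurableType d).

Lemma small_jumpE (u : R) : \1_(@small_jump R) u = (`|u| <= 1)%R%:R :> R.
Proof.
rewrite indicE; congr ((nat_of_bool _)%:R).
by apply/idP/idP => [|h]; rewrite inE.
Qed.

Lemma measurable_small_jump (f : T -> R) : measurable_fun setT f ->
  measurable_fun setT (fun x => \1_(@small_jump R) (f x) : R).
Proof.
move=> mf; under eq_fun do rewrite small_jumpE.
apply: measurable_natr_le; first exact: measurable_norm_comp.
exact: measurable_cst_real.
Qed.

End measurable_small_jump.

(** Closes the measurability of a real function given by an explicit formula,
    measurable hypotheses being used for its unknown functions. *)
Ltac measurability :=
  repeat first
    [ assumption
    | exact: measurable_cst_real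
    | exact: measurable_id
    | exact: measurable_fst
    | exact: measurable_snd
    | match goal with H : measurable_fun _ ?f |- measurable_fun _ (fun x => ?f _) =>
        apply: (measurableT_comp H) end
    | apply: measurable_small_jump
    | apply: measurable_natr_le
    | apply: measurable_sin_comp
    | apply: measurable_cos_comp
    | apply: measurable_norm_comp
    | apply: measurable_min_comp
    | apply: measurable_add
    | apply: measurable_opp
    | apply: measurable_pow
    | apply: measurable_mul ].

(** * Pointwise bounds by the weight min(1, u^2) *)

Section levy_weight.
Context (R : realType).
Implicit Types u h z l : R.

(** All jump integrals are dominated by multiples of this weight, whose integral
    is finite by definition of a Levy measure. *)
Definition levy_weight (u : R) : R := Num.min 1 (u ^+ 2).

Lemma levy_weight_small u : `|u| <= 1 -> levy_weight u = u ^+ 2.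
Proof.
move=> u1; apply/min_idPr.
by rewrite -(real_normK (num_real u)); have := normr_ge0 u; nra.
Qed.

Lemma levy_weight_large u : 1 < `|u| -> levy_weight u = 1.
Proof.
move=> u1; apply/min_idPl.
by rewrite -(real_normK (num_real u)); have := normr_ge0 u; nra.
Qed.

Lemma levy_weight_ge0 u : 0 <= levy_weight u.
Proof. by rewrite le_min ler01 sqr_ge0. Qed.

Lemma measurable_levy_weight : measurable_fun setT levy_weight.
Proof. by rewrite /levy_weight; measurability. Qed.

Lemma small_jump_in u : `|u| <= 1 -> \1_(@small_jump R) u = 1 :> R.
Proof. by move=> u1; rewrite small_jumpE u1. Qed.

Lemma small_jump_out u : 1 < `|u| -> \1_(@small_jump R) u = 0 :> R.
Proof. by move=> u1; rewrite small_jumpE leNgt u1. Qed.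

Lemma onem_cos_weight h u :
  `|1 - cos (h * u)| <= (h ^+ 2 + 2) * levy_weight u.
Proof.
rewrite ger0_norm ?subr_ge0 ?cos_le1//.
have [u1|u1] := leP `|u| 1.
  rewrite levy_weight_small//; apply: le_trans (onem_cos_le _) _.
  by rewrite exprMn mulrDl lerDl mulr_ge0// sqr_ge0.
rewrite levy_weight_large// mulr1.
by have := cos_geN1 (h * u); have := sqr_ge0 h; lra.
Qed.

Lemma sin_comp_weight z u :
  `|sin (u * z) - u * z * \1_(@small_jump R) u| <= (z ^+ 2 + 1) * levy_weight u.
Proof.
have [u1|u1] := leP `|u| 1.
  rewrite levy_weight_small// small_jump_in// mulr1.
  apply: le_trans (sin_sub_id_le _) _; rewrite exprMn.
  by have := sqr_ge0 z; have := sqr_ge0 u; nra.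
rewrite levy_weight_large// small_jump_out// mulr0 subr0 mulr1.
by have := sin_max (u * z); have := sqr_ge0 z; lra.
Qed.

(** This is |e^(ihu) - 1| on the large jumps, the part of an increment of the
    exponent that is not O(h). *)
Definition large_osc h u : R :=
  (1 - \1_(@small_jump R) u) * (2 * `|sin (h * u / 2)|).

Lemma large_osc_small h u : `|u| <= 1 -> large_osc h u = 0.
Proof. by move=> u1; rewrite /large_osc small_jump_in// subrr mul0r. Qed.

Lemma large_osc_large h u : 1 < `|u| -> large_osc h u = 2 * `|sin (h * u / 2)|.
Proof. by move=> u1; rewrite /large_osc small_jump_out// subr0 mul1r. Qed.

Lemma large_osc_ge0 h u : 0 <= large_osc h u.
Proof.
have [u1|u1] := leP `|u| 1; first by rewrite large_osc_small.
by rewrite large_osc_large// mulr_ge0.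
Qed.

Lemma large_osc_weight h u : `|large_osc h u| <= 2 * levy_weight u.
Proof.
rewrite ger0_norm ?large_osc_ge0//.
have [u1|u1] := leP `|u| 1.
  by rewrite large_osc_small// mulr_ge0// levy_weight_ge0.
by rewrite large_osc_large// levy_weight_large// ler_pM2l// sin_max.
Qed.

Lemma large_oscN h u : large_osc (- h) u = large_osc h u.
Proof. by rewrite /large_osc !mulNr sinN normrN. Qed.

(** Pointwise form of the Cauchy-Schwarz inequality, with t to be optimised: the
    square of |e^(ihu) - 1| is 2 (1 - cos(h u)). *)
Lemma large_osc_amgm h u t : 0 < t ->
  large_osc h u <= t * levy_weight u + (2 / t) * (1 - cos (h * u)).
Proof.
move=> t0; have c1 := cos_le1 (h * u).
have [u1|u1] := leP `|u| 1.
  rewrite large_osc_small// addr_ge0 ?mulr_ge0 ?levy_weight_ge0 ?subr_ge0 //.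
  exact: ltW.
  by rewrite invr_ge0 ltW.
rewrite large_osc_large// levy_weight_large// mulr1 onem_cosE.
rewrite -(real_normK (num_real (sin _))); set s := `|_|.
have -> : 2 / t * (2 * s ^+ 2) = (4 * s ^+ 2) / t by field; rewrite gt_eqF.
have tE : (t + 4 * s ^+ 2 / t) * t = t ^+ 2 + 4 * s ^+ 2.
  by field; rewrite gt_eqF.
rewrite -(ler_pM2r t0) tE.
have := sqr_ge0 (t - 2 * s); nra.
Qed.

(** On a small jump both factors of the product formula for cos p - cos q are
    small, which gives the factor u^2 of the weight; on a large jump one of them
    is kept, and it is |e^(ihu) - 1|. *)
Lemma cos_increment z h l u : `|z| + `|h| <= l ->
  `|cos (u * (z + h)) - cos (u * z)| <=
  `|h| * l * levy_weight u + large_osc h u.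
Proof.
move=> zhl; rewrite cos_subE normrN !normrM (@ger0_norm _ 2)//.
have -> : (u * (z + h) - u * z) / 2 = h * u / 2 by ring.
have -> : (u * (z + h) + u * z) / 2 = u * (z + h / 2) by field.
have n0 := normr_ge0 (sin (h * u / 2)); have n1 := normr_ge0 (sin (u * (z + h / 2))).
have [u1|u1] := leP `|u| 1.
  rewrite large_osc_small// addr0 levy_weight_small//.
  have := sin_lipschitz0 (h * u / 2); rewrite normr_half normrM.
  have := sin_lipschitz0 (u * (z + h / 2)); rewrite normrM.
  have : `|z + h / 2| <= l.
    apply: le_trans (ler_normD _ _) _; rewrite normr_half.
    by have := normr_ge0 h; lra.
  rewrite -(real_normK (num_real u)).
  have := normr_ge0 h; have := normr_ge0 u; have := normr_ge0 (z + h / 2).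
  set a := `|sin _|; set b := `|sin _|; move: `|u| `|h| `|z + _| => U H Z *.
  have a1 : a <= U * l by nra.
  have : a * b <= (U * l) * (H * U / 2) by rewrite ler_pM//.
  nra.
rewrite large_osc_large// levy_weight_large// mulr1.
have := sin_max (u * (z + h / 2)).
have : 0 <= `|h| * l.
  by rewrite mulr_ge0// (le_trans _ zhl)// addr_ge0.
nra.
Qed.

(** The small-jump case of [sin_increment], with c, s, k, A standing for
    |cos a - 1|, |sin b - b|, |cos a| and |a|. *)
Lemma sin_increment_arith (U H Z l c s k A : R) : 0 <= c ->
  0 <= Z -> 0 <= U -> 0 <= H -> Z + H <= l -> A <= U * (Z + H / 2) -> 0 <= s -> 0 <= k ->
  k <= 1 -> c <= A -> s <= (H * U / 2) ^+ 2 ->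
  k * s + H * U / 2 * c <= H * (l * U ^+ 2).
Proof.
move=> c0 Z0 U0 H0 zhl A1 s0 k0 k1 cA sb.
have h1 : k * s <= (H * U / 2) ^+ 2 by nra.
have h3 : H * U / 2 * c <= H * U / 2 * (U * (Z + H / 2)).
  by rewrite ler_wpM2l ?(le_trans cA)// mulr_ge0// mulr_ge0.
have h4 : H * (U ^+ 2 * (Z + H)) <= H * (U ^+ 2 * l).
  by rewrite ler_wpM2l// ler_wpM2l// sqr_ge0.
have h5 : 0 <= H * (U ^+ 2 * Z) by rewrite mulr_ge0// mulr_ge0// sqr_ge0.
have h6 : 0 <= H * (U ^+ 2 * H) by rewrite mulr_ge0// mulr_ge0// sqr_ge0.
rewrite [l * _]mulrC; lra.
Qed.

(** Same splitting as for the cosine.  The compensator removes the term of order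
    one, which for the sine does not vanish on small jumps. *)
Lemma sin_increment z h l u : `|z| + `|h| <= l ->
  `|sin (u * (z + h)) - sin (u * z) - u * h * \1_(@small_jump R) u| <=
  2 * `|h| * l * levy_weight u + large_osc h u.
Proof.
move=> zhl; rewrite sin_subE.
have -> : (u * (z + h) - u * z) / 2 = h * u / 2 by ring.
have -> : (u * (z + h) + u * z) / 2 = u * (z + h / 2) by field.
have [u1|u1] := leP `|u| 1.
  rewrite large_osc_small// addr0 levy_weight_small// small_jump_in// mulr1.
  set a := u * (z + h / 2); set b := h * u / 2.
  have -> : 2 * cos a * sin b - u * h =
    2 * (cos a * (sin b - b) + b * (cos a - cos 0)).
    by rewrite cos0 /b; field.
  rewrite normrM (@ger0_norm _ 2)// -!mulrA ler_pM2l//.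
  apply: le_trans (ler_normD _ _) _; rewrite !normrM.
  have := sin_sub_id_le b; have := cos_lipschitz a 0; rewrite subr0.
  have := cos_max a; have := normr_ge0 (cos a); have := normr_ge0 (sin b - b).
  have : `|a| <= `|u| * (`|z| + `|h| / 2).
    rewrite normrM ler_wpM2l// (le_trans (ler_normD _ _))//.
    by rewrite normr_half.
  move: zhl; have bE : `|b| = `|h| * `|u| / 2 by rewrite normr_half normrM.
  rewrite -(real_normK (num_real b)) -(real_normK (num_real u)) bE.
  have := normr_ge0 h; have := normr_ge0 u; have := normr_ge0 z.
  have := normr_ge0 (cos a - cos 0).
  rewrite (@ger0_norm _ 2^-1) ?invr_ge0//.
  rewrite [`|h| * (`|u| * _)]mulrA [`|h| * `|u| * (_ * _)]mulrA.
  exact: sin_increment_arith.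
rewrite large_osc_large// levy_weight_large// small_jump_out// mulr0 subr0 mulr1.
rewrite !normrM (@ger0_norm _ 2)//.
have := cos_max (u * (z + h / 2)).
have n0 := normr_ge0 (sin (h * u / 2)); have n1 := normr_ge0 (cos (u * (z + h / 2))).
have : 0 <= `|h| * l.
  by rewrite mulr_ge0// (le_trans _ zhl)// addr_ge0.
nra.
Qed.

End levy_weight.

(** * Real and imaginary parts of the characteristic exponent *)

Section levy_integrals.
Context (R : realType) (nu : {measure set (measurableTypeR R) -> \bar R}).
Hypothesis weight_int : nu.-integrable setT (EFin \o @levy_weight R).
Implicit Types u h z l t : R.

Definition levy_mass : R := \int[nu]_u levy_weight u.
Let N := levy_mass.

Lemma levy_mass_ge0 : 0 <= levy_mass.
Proof. by apply: Rintegral_ge0 => u _; exact: levy_weight_ge0. Qed.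

Lemma integrable_levy (f : measurableTypeR R -> R) C : measurable_fun setT f ->
  (forall u, `|f u| <= C * levy_weight u) -> nu.-integrable setT (EFin \o f).
Proof.
move=> mf; apply: (@integrable_dominated _ _ _ _ _ (fun u : measurableTypeR R => C * levy_weight u)) => //.
exact: integrableZ.
Qed.

Lemma Rintegral_levy_le (f : measurableTypeR R -> R) C : measurable_fun setT f ->
  (forall u, `|f u| <= C * levy_weight u) -> `|\int[nu]_u f u| <= C * levy_mass.
Proof.
move=> mf fC; rewrite -RintegralZl//.
apply: (@Rintegral_norm_le _ _ _ _ _ (fun u : measurableTypeR R => C * levy_weight u)) => //.
exact: integrableZ.
Qed.

(** Up to the Gaussian term this is minus the real part of the exponent. *)
Definition levy_osc h : R := \int[nu]_u (1 - cos (h * u)).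
Definition levy_large_osc h : R := \int[nu]_u large_osc h u.

Definition levy_re (sigma z : R) : R :=
  - (sigma ^+ 2 * z ^+ 2 / 2) + \int[nu]_u (cos (u * z) - 1).
Definition levy_im (beta z : R) : R :=
  beta * z + \int[nu]_u (sin (u * z) - u * z * \1_(@small_jump R) u).

Lemma integrable_onem_cos h : nu.-integrable setT (EFin \o (fun u : measurableTypeR R => 1 - cos (h * u))).
Proof. by apply: integrable_levy (onem_cos_weight h); measurability. Qed.

Lemma integrable_cosB1 z : nu.-integrable setT (EFin \o (fun u : measurableTypeR R => cos (u * z) - 1)).
Proof.
apply: (@integrable_levy _ (z ^+ 2 + 2)); first by measurability.
by move=> u; rewrite distrC mulrC onem_cos_weight.
Qed.

Lemma integrable_sin_comp z : nu.-integrable setT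
  (EFin \o (fun u : measurableTypeR R => sin (u * z) - u * z * \1_(@small_jump R) u)).
Proof. by apply: integrable_levy (sin_comp_weight z); measurability. Qed.

Lemma integrable_large_osc h : nu.-integrable setT (EFin \o large_osc h).
Proof.
by apply: integrable_levy (large_osc_weight h); rewrite /large_osc; measurability.
Qed.

Lemma levy_osc_ge0 h : 0 <= levy_osc h.
Proof. by apply: Rintegral_ge0 => u _; rewrite subr_ge0 cos_le1. Qed.

Lemma levy_reE sigma z :
  levy_re sigma z = - (sigma ^+ 2 * z ^+ 2 / 2) - levy_osc z.
Proof.
rewrite /levy_re /levy_osc; congr (_ + _).
rewrite -[RHS]mulN1r -RintegralZl//; last exact: integrable_onem_cos.
by apply: eq_RintegralT => u; rewrite mulrC; ring.
Qed.

Lemma levy_large_oscN h : levy_large_osc (- h) = levy_large_osc h.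
Proof. by apply: eq_RintegralT => u; exact: large_oscN. Qed.

(** With t of order sqrt(levy_osc h) this bounds the left-hand side by a multiple
    of sqrt(levy_osc h). *)
Lemma levy_large_osc_le h t : 0 < t ->
  levy_large_osc h <= t * N + (2 / t) * levy_osc h.
Proof.
move=> t0; rewrite /N /levy_mass /levy_osc -!RintegralZl//; last exact: integrable_onem_cos.
rewrite -RintegralD//; [|exact: integrableZ|]; last first.
  by apply: integrableZ; exact: integrable_onem_cos.
apply: le_Rintegral => //; first exact: integrable_large_osc.
  apply: integrableD_real; first exact: integrableZ.
  by apply: integrableZ; exact: integrable_onem_cos.
by move=> u _; exact: large_osc_amgm.
Qed.

Lemma levy_re_increment sigma z h l : `|z| + `|h| <= l ->
  `|levy_re sigma (z + h) - levy_re sigma z| <=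
  `|h| * (2 * l * (sigma ^+ 2 + N)) + levy_large_osc h.
Proof.
move=> zhl; rewrite /levy_re.
have -> (a b c e : R) : a + b - (c + e) = (a - c) + (b - e) by ring.
rewrite -RintegralB//; [|exact: integrable_cosB1|exact: integrable_cosB1].
have l0 : 0 <= l by rewrite (le_trans _ zhl)// addr_ge0.
apply: le_trans (ler_normD _ _) _.
set I := `|\int[nu]_ _ _|.
have hI : I <= `|h| * l * N + levy_large_osc h.
  have ii : nu.-integrable setT
    (EFin \o (fun u : measurableTypeR R => `|h| * l * levy_weight u + large_osc h u)).
    by apply: integrableD_real; [exact: integrableZ|exact: integrable_large_osc].
  rewrite /N /levy_mass -RintegralZl// -RintegralD//; first last.
    exact: integrable_large_osc.
    exact: integrableZ.
  apply: Rintegral_norm_le => //; first by measurability.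
  move=> u; rewrite (_ : _ - _ = cos (u * (z + h)) - cos (u * z)); last by ring.
  exact: cos_increment.
have hS : `|- (sigma ^+ 2 * (z + h) ^+ 2 / 2) - - (sigma ^+ 2 * z ^+ 2 / 2)| <=
    sigma ^+ 2 * (`|h| * l).
  have -> : - (sigma ^+ 2 * (z + h) ^+ 2 / 2) - - (sigma ^+ 2 * z ^+ 2 / 2) =
    - (sigma ^+ 2 * (h * (z + h / 2))) by field.
  rewrite normrN normrM (@ger0_norm _ (_ ^+ 2)) ?sqr_ge0// ler_wpM2l ?sqr_ge0//.
  rewrite normrM ler_wpM2l//; apply: le_trans (ler_normD _ _) _.
  by rewrite normr_half; have := normr_ge0 h; lra.
have := levy_mass_ge0; rewrite -/N => N0.
have : 0 <= `|h| * l * N by rewrite !mulr_ge0.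
have : 0 <= sigma ^+ 2 * (`|h| * l) by rewrite mulr_ge0 ?sqr_ge0// mulr_ge0.
lra.
Qed.

Lemma levy_im_increment beta z h l : `|z| + `|h| <= l ->
  `|levy_im beta (z + h) - levy_im beta z| <=
  `|h| * (`|beta| + 2 * l * N) + levy_large_osc h.
Proof.
move=> zhl; rewrite /levy_im.
have -> (a b c e : R) : a + b - (c + e) = (a - c) + (b - e) by ring.
rewrite -RintegralB//; [|exact: integrable_sin_comp|exact: integrable_sin_comp].
apply: le_trans (ler_normD _ _) _.
set I := `|\int[nu]_ _ _|.
have hI : I <= 2 * `|h| * l * N + levy_large_osc h.
  have ii : nu.-integrable setT
    (EFin \o (fun u : measurableTypeR R => 2 * `|h| * l * levy_weight u + large_osc h u)).
    by apply: integrableD_real; [exact: integrableZ|exact: integrable_large_osc].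
  rewrite /N /levy_mass -RintegralZl// -RintegralD//; first last.
    exact: integrable_large_osc.
    exact: integrableZ.
  apply: Rintegral_norm_le => //; first by measurability.
  move=> u.
  rewrite (_ : _ - _ = sin (u * (z + h)) - sin (u * z) - u * h * \1_(@small_jump R) u);
    last by ring.
  exact: sin_increment.
have -> : beta * (z + h) - beta * z = beta * h by ring.
rewrite normrM; lra.
Qed.

End levy_integrals.

(** * Integrals over bounded intervals *)

Section interval_integrals.
Context (R : realType).
Notation mu := (@lebesgue_measure R).

Lemma Rintegral_indic d (T : measurableType d) (m : {measure set T -> \bar R})
    (D : set T) (f : T -> R) :
  \int[m]_x (\1_D x * f x) = \int[m]_(x in D) f x.
Proof.
rewrite [RHS]Rintegral_mkcond; apply: eq_RintegralT => x.
by rewrite patch_indic mulrC.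
Qed.

Lemma Rintegral_FTC (f F : R -> R) (a b : R) : a <= b -> continuous f ->
  (forall x : R, is_derive x 1 F (f x)) -> \int[mu]_(x in `[a, b]) f x = F b - F a.
Proof.
rewrite le_eqVlt => /predU1P[<-|ab] cf dF.
  by rewrite set_itv1 Rintegral_set1 subrr.
have cF : continuous F.
  by move=> x; apply/differentiable_continuous/derivable1_diffP; have [] := dF x.
rewrite /Rintegral (@continuous_FTC2 _ f F)//.
- exact: continuous_subspaceT.
- split=> [x _||].
  + by have [] := dF x.
  + exact/cvg_at_right_filter/cF.
  + exact/cvg_at_left_filter/cF.
- by move=> x _; rewrite derive1E; exact: derive_val.
Qed.

Lemma Rintegral_itv1 (a b : R) : a <= b ->
  \int[mu]_x (\1_`[a, b] x : R) = b - a.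
Proof.
rewrite le_eqVlt => ab; under eq_RintegralT do rewrite -[\1__ _]mulr1.
rewrite Rintegral_indic Rintegral_cst// mul1r /= lebesgue_measure_itv/= lte_fin.
by case/predU1P: ab => [->|->]//; rewrite ltxx subrr.
Qed.

Lemma is_derive_sinM (a x : R) :
  is_derive x 1 (fun y => sin (y * a)) (a * cos (x * a)).
Proof.
have dg : is_derive x 1 (fun y : R => y * a) a.
  by apply: is_derive_eq; rewrite scaler0 add0r scaler1.
by rewrite mulrC; exact: (@is_derive1_comp _ sin (fun y => y * a) x _ _ (is_derive_sin (x * a)) dg).
Qed.

Lemma is_derive_cosM (a x : R) :
  is_derive x 1 (fun y => cos (y * a)) (- (a * sin (x * a))).
Proof.
have dg : is_derive x 1 (fun y : R => y * a) a.
  by apply: is_derive_eq; rewrite scaler0 add0r scaler1.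
by rewrite mulrC -mulNr; exact: (@is_derive1_comp _ cos (fun y => y * a) x _ _ (is_derive_cos (x * a)) dg).
Qed.

Lemma continuous_cosM (a : R) : continuous (fun y : R => cos (y * a)).
Proof.
by move=> x; apply/differentiable_continuous/derivable1_diffP;
  have [] := is_derive_cosM a x.
Qed.

Lemma Rintegral_onem_cos (u t : R) : 0 <= t -> u != 0 ->
  \int[mu]_(h in `[0, t]) (1 - cos (h * u)) = t - sin (t * u) / u.
Proof.
move=> t0 u0.
have dF (h : R) : is_derive h 1 (fun h => h - sin (h * u) / u) (1 - cos (h * u)).
  have ds := is_derive_sinM u h.
  apply: is_derive_eq.
  by rewrite scaler0 add0r /GRing.scale/= mulrA mulVf// mul1r.
rewrite (Rintegral_FTC t0 _ dF); first by rewrite mul0r sin0 mul0r !subr0.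
by move=> h; apply: cvgB; [exact: cvg_cst|exact: continuous_cosM].
Qed.

End interval_integrals.

(** * What differentiability of the characteristic function gives *)

Section small_frequencies.
Context (R : realType) (nu : {sigma_finite_measure set (measurableTypeR R) -> \bar R}).
Hypothesis weight_int : nu.-integrable setT (EFin \o @levy_weight R).
Context (beta sigma : R) (c s : R -> R).
Hypothesis cE : forall z, c z = expR (levy_re nu sigma z) * cos (levy_im nu beta z).
Hypothesis sE : forall z, s z = expR (levy_re nu sigma z) * sin (levy_im nu beta z).
Hypothesis dc : forall z : R, derivable c z 1.
Hypothesis ds : forall z : R, derivable s z 1.

(** The modulus of the characteristic function does not vanish, so its logarithm
    inherits the differentiability of its components. *)
Lemma levy_re_ln z : levy_re nu sigma z = ln (c z ^+ 2 + s z ^+ 2) / 2.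
Proof.
have -> : c z ^+ 2 + s z ^+ 2 = expR (2%:R * levy_re nu sigma z).
  by rewrite cE sE !exprMn -mulrDr cos2Dsin2 mulr1 expRM_natl.
by rewrite expRK mulrAC mulfV ?mul1r// pnatr_eq0.
Qed.

Lemma levy_re0 : levy_re nu sigma 0 = 0.
Proof.
rewrite levy_reE// /levy_osc; under eq_RintegralT do rewrite mul0r cos0 subrr.
by rewrite Rintegral_cst// mul0r expr0n/= mulr0 mul0r oppr0 addr0.
Qed.

Lemma levy_osc_le_re z : levy_osc nu z <= - levy_re nu sigma z.
Proof.
rewrite levy_reE// opprD !opprK lerDr divr_ge0// mulr_ge0 ?sqr_ge0//.
Qed.

(** The modulus of the characteristic function is at most 1, its value at 0, so
    0 is a critical point. *)
Lemma is_derive_levy_re0 : is_derive (0 : R) 1 (levy_re nu sigma) 0.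
Proof.
have d z : derivable (levy_re nu sigma) z 1.
  rewrite (_ : levy_re _ _ = (fun z => ln (c z ^+ 2 + s z ^+ 2) * 2^-1)); last first.
    by apply/funext => t; exact: levy_re_ln.
  apply: derivableM; last exact: derivable_cst.
  have gt0 : 0 < c z ^+ 2 + s z ^+ 2.
    by rewrite cE sE !exprMn -mulrDr cos2Dsin2 mulr1 exprn_gt0// expR_gt0.
  have dN : derivable (fun z => c z ^+ 2 + s z ^+ 2) z 1.
    have -> : (fun z => c z ^+ 2 + s z ^+ 2) = (c * c + s * s)%R.
      by apply/funext => t; rewrite !expr2.
    exact: (derivableD (derivableM (@dc z) (@dc z)) (derivableM (@ds z) (@ds z))).
  have := @is_derive1_comp R (@ln R) (fun z => c z ^+ 2 + s z ^+ 2) z _ _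
    (is_derive1_ln gt0) (derivableP dN).
  by case.
apply: (@derive1_at_max R _ (-1) 1) => //.
- by rewrite in_itv/= ltrN10 ltr01.
- by move=> t _; rewrite levy_re0 -oppr_ge0 (le_trans _ (levy_osc_le_re _))// levy_osc_ge0.
Qed.

Lemma levy_osc_little_o (e : R) : 0 < e ->
  exists2 dl : R, 0 < dl & forall h, 0 < h -> h < dl -> levy_osc nu h <= e * h.
Proof.
move=> e0; have [dA A0] := is_derive_levy_re0.
have : (fun h => h^-1 *: ((levy_re nu sigma \o shift 0) (h *: 1) - levy_re nu sigma 0))
    @ 0^' --> 'D_1 (levy_re nu sigma) (0 : R) by exact: dA.
rewrite A0 => /cvgrPdist_le /(_ _ e0) /nbhs_ballP [dl dl0 H].
exists dl => // h h0 hd.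
have := H h; rewrite /ball/= sub0r normrN gtr0_norm// => /(_ hd).
rewrite gt_eqF// => /(_ isT).
rewrite sub0r normrN levy_re0 subr0 /= addr0 scaler1.
rewrite normrZ normfV gtr0_norm// ler_pdivrMl// [h * e]mulrC.
by apply: le_trans; rewrite (le_trans (levy_osc_le_re h))// ler_normr lexx orbT.
Qed.

(** Indicator of the large jumps that can bring x near 0: if 2|u| <= |x| then
    |x + u| >= |u|. *)
Definition far_jump (x u : R) : R :=
  (1 - \1_(@small_jump R) u) * (1 - (2 * `|u| <= `|x|)%R%:R).

Lemma far_jump_ge0 x u : 0 <= far_jump x u.
Proof.
by rewrite /far_jump small_jumpE mulr_ge0// subr_ge0 lern1 leq_b1.
Qed.

Lemma far_jump_le1 x u : far_jump x u <= 1.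
Proof.
by rewrite /far_jump small_jumpE mulr_ile1// ?subr_ge0 ?gerBl// lern1 leq_b1.
Qed.

Lemma far_jump_weight x u : `|far_jump x u| <= 1 * levy_weight u.
Proof.
rewrite ger0_norm ?far_jump_ge0// mul1r.
have [u1|u1] := leP `|u| 1.
  by rewrite /far_jump small_jump_in// subrr mul0r levy_weight_ge0.
by rewrite levy_weight_large// far_jump_le1.
Qed.

Lemma measurable_far_jump x : measurable_fun setT (far_jump x).
Proof. by rewrite /far_jump; measurability. Qed.

(** By [Rintegral_onem_cos] the right-hand side is t - sin(t u)/u, and
    |sin(t u)/u| <= t/2 when |t u| >= 2. *)
Lemma far_jump_average x u t : 0 <= t -> 4 <= t * `|x| ->
  t / 2 * far_jump x u <= \int[lebesgue_measure]_(h in `[0, t]) (1 - cos (h * u)).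
Proof.
move=> t0 tx.
have I0 : 0 <= \int[lebesgue_measure]_(h in `[0, t]) (1 - cos (h * u)).
  by apply: Rintegral_ge0 => h _; rewrite subr_ge0 cos_le1.
rewrite /far_jump; have [u1|u1] := leP `|u| 1.
  by rewrite small_jump_in// subrr mul0r mulr0.
rewrite small_jump_out// subr0 mul1r.
have [ux|ux] := leP (2 * `|u|) `|x|; first by rewrite subrr mulr0.
rewrite subr0 mulr1.
have u0 : u != 0 by rewrite -normr_gt0 (lt_trans ltr01).
rewrite Rintegral_onem_cos// lerBrDl -lerBrDr.
apply: le_trans (ler_norm _) _; rewrite normrM normfV ler_pdivrMr ?normr_gt0//.
have := sin_max (t * u); nra.
Qed.

(** This is nu(|u| > r) = O(1/r).  For |x| large, integrate [far_jump_average]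
    with t = 4/|x| against nu and exchange the integrals: the result is at most
    the integral over [0, t] of [levy_osc], which is at most t there. *)
Lemma far_jump_tail : exists K : R, forall x, `|x| * (\int[nu]_u far_jump x u) <= K.
Proof.
have [dl dl0 Hdl] := levy_osc_little_o ltr01.
(* 8 serves |x| > 8 / dl; for smaller |x| the trivial bound by the mass is enough *)
exists (8 + 8 / dl * levy_mass nu) => x.
have I0 : 0 <= \int[nu]_u far_jump x u.
  by apply: Rintegral_ge0 => u _; exact: far_jump_ge0.
have M0 : 0 <= levy_mass nu by exact: levy_mass_ge0.
have [xs|xl] := leP `|x| (8 / dl).
  have I1 : \int[nu]_u far_jump x u <= levy_mass nu.
    rewrite -[leRHS]mul1r; apply: le_trans (ler_norm _) _.
    apply: Rintegral_levy_le => //; first exact: measurable_far_jump.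
    exact: far_jump_weight.
  apply: le_trans (ler_pM (normr_ge0 _) I0 xs I1) _.
  by rewrite lerDr.
have x0 : 0 < `|x| by rewrite (le_lt_trans _ xl)// divr_ge0// ltW.
pose t := 4 / `|x|.
have t0 : 0 < t by rewrite divr_gt0.
have tdl : t < dl.
  by rewrite ltr_pdivrMr// mulrC -ltr_pdivrMr// (le_lt_trans _ xl)// ler_pM2r ?invr_gt0// ler_nat.
have osc_t h : `[0, t]%classic h -> levy_osc nu h <= t.
  rewrite /= in_itv/= => /andP[]; rewrite le_eqVlt => /predU1P[<- _|h0 ht].
    have := levy_osc_le_re 0; rewrite levy_re0 oppr0 => /le_trans; apply; exact: ltW.
  by rewrite (le_trans (Hdl _ h0 (le_lt_trans ht tdl)))// mul1r.
pose f (p : measurableTypeR R * measurableTypeR R) : R :=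
  \1_(`[0, t]%classic : set R) p.2 * (1 - cos (p.2 * p.1)).
have mI : measurable_fun setT (\1_(`[0, t]%classic : set R) : measurableTypeR R -> R).
  exact: measurable_indic.
have mf : measurable_fun setT f by rewrite /f; measurability.
have Ii := @integrable_indic_itv R 0 t true false.
have fab u h : `|f (u, h)| <= ((t ^+ 2 + 2) * levy_weight u) * \1_(`[0, t]%classic : set R) h.
  rewrite /f/= normrM mulrC indicE.
  have [|_] := boolP (h \in _); last by rewrite normr0 !mulr0.
  rewrite inE /= in_itv/= => /andP[h0 ht].
  rewrite normr1 !mulr1 (le_trans (onem_cos_weight _ _))//.
  rewrite ler_wpM2r ?levy_weight_ge0// lerD2r lerXn2r// nnegrE//; exact: ltW.
have wi : nu.-integrable setT (EFin \o (fun u : measurableTypeR R => (t ^+ 2 + 2) * levy_weight u)).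
  exact: integrableZ.
have F := Rintegral_fubini mf wi Ii fab.
have lower : t / 2 * (\int[nu]_u far_jump x u) <=
    \int[nu]_u \int[lebesgue_measure]_h f (u, h).
  have ij : nu.-integrable setT (EFin \o far_jump x).
    apply: (integrable_levy weight_int _ (far_jump_weight x)).
    exact: measurable_far_jump.
  rewrite -RintegralZl//; apply: le_Rintegral => //.
  - exact: integrableZ.
  - exact: (integrable_Rintegral1 mf wi Ii fab).
  - move=> u _; rewrite /f/= Rintegral_indic; apply: far_jump_average; first exact: ltW.
    by rewrite /t divfK// gt_eqF.
have upper : \int[lebesgue_measure]_h \int[nu]_u f (u, h) <= t * t.
  apply: (@le_trans _ _ (\int[lebesgue_measure]_h (t * \1_(`[0, t]%classic : set R) h))).
    apply: le_Rintegral => //.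
    + exact: (integrable_Rintegral2 mf wi Ii fab).
    + exact: integrableZ.
    + move=> h _; rewrite /f/=; rewrite RintegralZl//; last exact: integrable_onem_cos.
      rewrite indicE; have [|_] := boolP (h \in _); last by rewrite mul0r mulr0.
      by rewrite inE => /osc_t; rewrite mul1r mulr1.
  by rewrite RintegralZl// Rintegral_itv1 ?subr0// ltW.
rewrite F in lower; have {lower}lt := le_trans lower upper.
have : `|x| * (\int[nu]_u far_jump x u) <= 8.
  have -> : 8 = `|x| * (2 * t) by rewrite /t; field; rewrite gt_eqF.
  rewrite ler_pM2l// -(ler_pM2l t0); lra.
have : 0 <= 8 / dl * levy_mass nu by rewrite mulr_ge0// divr_ge0// ltW.
lra.
Qed.

End small_frequencies.

(** * The Stein operator with a frequency step *)

Section stein_operator.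
Context (R : realType) (nu : {sigma_finite_measure set (measurableTypeR R) -> \bar R}).
Hypothesis weight_int : nu.-integrable setT (EFin \o @levy_weight R).
Context (beta sigma K : R).
Hypothesis tail : forall x, `|x| * (\int[nu]_u far_jump x u) <= K.
Implicit Types (g s : R -> R) (x u h M : R).

(** The bounds on a test function that make its jump integral bounded.  They pass
    to pointwise limits and hold uniformly for the Fejer means. *)
Definition tame M g : Prop :=
  [/\ forall x, `|g x| <= M, forall x, `|x * g x| <= M
    & forall x y, `|g x - g y| <= M * `|x - y|].

(** A factor replacing u in the jump integral and x in the operator.  The
    identity gives the operator itself, and [sin_step h] the symmetric difference
    quotient of step h on the Fourier side. *)
Definition frequency_step s : Prop :=
  [/\ measurable_fun setT s, forall u, `|s u| <= `|u|
    & forall u, `|s u - u| <= u ^+ 2].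

Definition jump_term s g x u : R :=
  g (x + u) * s u - u * \1_(@small_jump R) u * g x.

Definition jump_int s g x : R := \int[nu]_u jump_term s g x u.

(** The second test function stands for the derivative of the first one.  Keeping
    the two separate avoids differentiating superpositions and Fejer means. *)
Definition stein_step s g g1 x : R :=
  g x * s x - beta * g x - sigma ^+ 2 * g1 x - jump_int s g x.

Lemma tame_ge0 M g : tame M g -> 0 <= M.
Proof. by case=> /(_ 0) h _ _; exact: le_trans h. Qed.

Lemma tame_continuous M g : tame M g -> continuous g.
Proof.
move=> tg; have M0 := tame_ge0 tg; case: tg => _ _ gl x.
have M1 : 0 < M + 1 by rewrite ltr_wpDl.
apply/cvgrPdist_le => e e0; have d0 : 0 < e / (M + 1) by rewrite divr_gt0.
near=> y; apply: le_trans (gl _ _) _.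
apply: (@le_trans _ _ ((M + 1) * `|x - y|)); first by rewrite ler_wpM2r// lerDl.
rewrite mulrC -(ler_pdivlMr _ _ M1).
near: y; exact: (@cvgr_dist_le _ _ _ _ _ id x cvg_id _ d0).
Unshelve. all: by end_near. Qed.

Lemma tame_measurable M g : tame M g -> measurable_fun setT g.
Proof. by move=> /tame_continuous /continuous_measurable_fun. Qed.

(** For a large jump, the bound on y g(y) controls |u| |g(x + u)| if
    2|u| <= |x|, since then |u| <= |x + u|; otherwise |u| <= |x + u| + |x| costs
    the extra term with [far_jump]. *)
Lemma jump_term_le M s g x u : frequency_step s -> tame M g ->
  `|jump_term s g x u| <= 3 * M * levy_weight u + M * `|x| * far_jump x u.
Proof.
move=> [_ s1 s2] tg; have M0 := tame_ge0 tg; case: tg => g0 gx gl.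
rewrite /jump_term; have [u1|u1] := leP `|u| 1.
  rewrite /far_jump small_jump_in// subrr mul0r mulr0 addr0 mulr1.
  rewrite levy_weight_small//.
  have -> : g (x + u) * s u - u * g x =
    (g (x + u) - g x) * s u + g x * (s u - u) by ring.
  apply: le_trans (ler_normD _ _) _; rewrite !normrM.
  have h1 := gl (x + u) x; rewrite addrAC subrr add0r in h1.
  have := s1 u; have := s2 u; have := g0 x.
  rewrite -(real_normK (num_real u)).
  have := normr_ge0 u; have := normr_ge0 (g (x + u) - g x).
  have := normr_ge0 (g x); have := normr_ge0 (s u); have := normr_ge0 (s u - u).
  move=> a b c e f gM su2 su1.
  have h2 : `|g (x + u) - g x| * `|s u| <= M * `|u| * `|u| by exact: ler_pM.
  have h3 : `|g x| * `|s u - u| <= M * `|u| ^+ 2 by exact: ler_pM.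
  have h4 : 0 <= M * `|u| ^+ 2 by rewrite mulr_ge0// exprn_ge0.
  lra.
rewrite /far_jump small_jump_out// !(mulr0, mul0r) !subr0 mul1r.
rewrite levy_weight_large// mulr1 normrM.
have h1 : `|g (x + u)| * `|s u| <= `|g (x + u)| * `|u| by rewrite ler_wpM2l.
have h2 := gx (x + u); rewrite normrM in h2.
have [ux|ux] := leP (2 * `|u|) `|x|.
  rewrite subrr mulr0 addr0.
  have h3 : `|u| <= `|x + u|.
    have := ler_normB (x + u) u; rewrite addrK; lra.
  have h4 : `|g (x + u)| * `|u| <= `|g (x + u)| * `|x + u| by rewrite ler_wpM2l.
  rewrite [`|g _| * `|x + u|]mulrC in h4; lra.
rewrite subr0 mulr1.
have h3 : `|u| <= `|x + u| + `|x|.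
  have := ler_normB (x + u) x; rewrite addrC addKr; lra.
have h4 : `|g (x + u)| * `|u| <= `|g (x + u)| * (`|x + u| + `|x|).
  by rewrite ler_wpM2l.
have h5 : `|g (x + u)| * `|x| <= M * `|x| by rewrite ler_wpM2r.
rewrite mulrDr [`|g _| * `|x + u|]mulrC in h4; lra.
Qed.

Lemma jump_term_weight M s g x u : frequency_step s -> tame M g ->
  `|jump_term s g x u| <= (3 * M + M * `|x|) * levy_weight u.
Proof.
move=> sf tg; apply: le_trans (jump_term_le x u sf tg) _.
rewrite [leRHS]mulrDl lerD2l ler_wpM2l ?mulr_ge0 ?(tame_ge0 tg)//.
apply: le_trans (ler_norm _) _; rewrite -[leRHS]mul1r.
exact: far_jump_weight.
Qed.

Lemma measurable_jump_term M s g x : frequency_step s -> tame M g ->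
  measurable_fun setT (jump_term s g x).
Proof.
move=> [ms _ _] /tame_measurable mg; rewrite /jump_term.
by measurability.
Qed.

Lemma integrable_jump_term M s g x : frequency_step s -> tame M g ->
  nu.-integrable setT (EFin \o jump_term s g x).
Proof.
move=> sf tg; apply: (integrable_levy weight_int).
  exact: measurable_jump_term sf tg.
by move=> u; exact: jump_term_weight sf tg.
Qed.

Lemma integrable_far_jump x : nu.-integrable setT (EFin \o far_jump x).
Proof.
apply: (integrable_levy weight_int _ (far_jump_weight x)).
exact: measurable_far_jump.
Qed.

(** The bound does not depend on x; this is where the tail estimate is needed. *)
Lemma jump_int_le M s g x : frequency_step s -> tame M g ->
  `|jump_int s g x| <= M * (3 * levy_mass nu + K).
Proof.
move=> sf tg; have M0 := tame_ge0 tg.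
apply: (@le_trans _ _ (3 * M * levy_mass nu + M * `|x| * \int[nu]_u far_jump x u)).
  rewrite /levy_mass -!RintegralZl//; last exact: integrable_far_jump.
  rewrite -RintegralD//; [|exact: integrableZ|]; last first.
    by apply: integrableZ; exact: integrable_far_jump.
  apply: Rintegral_norm_le.
  - exact: measurable_jump_term sf tg.
  - apply: integrableD_real; first exact: integrableZ.
    by apply: integrableZ; exact: integrable_far_jump.
  - by move=> u; exact: jump_term_le.
have := tail x => /(ler_wpM2l M0); lra.
Qed.

(** Step and test function may vary together: the case of a fixed test function
    serves for h -> 0, the case of a fixed step for the Fejer means. *)
Lemma jump_int_cvg M (s_ : nat -> R -> R) s (g_ : nat -> R -> R) g x :
  (forall n, frequency_step (s_ n)) -> frequency_step s ->
  (forall n, tame M (g_ n)) -> tame M g ->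
  (forall u, s_ n u @[n --> \oo] --> s u) ->
  (forall y, g_ n y @[n --> \oo] --> g y) ->
  jump_int (s_ n) (g_ n) x @[n --> \oo] --> jump_int s g x.
Proof.
move=> sf_ sf tg_ tg cs cg.
apply: (@Rintegral_dominated_cvg _ _ _ _ _ _
  (fun u : measurableTypeR R => (3 * M + M * `|x|) * levy_weight u)).
- by move=> n; exact: measurable_jump_term (sf_ n) (tg_ n).
- exact: measurable_jump_term sf tg.
- exact: integrableZ.
- by move=> n u; exact: jump_term_weight (sf_ n) (tg_ n).
- move=> u; apply: cvgB; first by apply: cvgM; [exact: cg|exact: cs].
  by apply: cvgM; [exact: cvg_cst|exact: cg].
Qed.

Lemma stein_step_le M s g g1 x : frequency_step s -> tame M g ->
  (forall y, `|g1 y| <= M) ->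
  `|stein_step s g g1 x| <=
    M * (1 + `|beta| + sigma ^+ 2 + (3 * levy_mass nu + K)).
Proof.
move=> sf tg g1M; have M0 := tame_ge0 tg; rewrite /stein_step.
have h1 := jump_int_le x sf tg.
case: tg sf => g0 gx _ [_ s1 _].
have h2 : `|g x * s x| <= M.
  apply: le_trans (gx x); rewrite !normrM mulrC ler_wpM2r//.
have h3 : `|beta * g x| <= `|beta| * M by rewrite normrM ler_wpM2l.
have h4 : `|sigma ^+ 2 * g1 x| <= sigma ^+ 2 * M.
  by rewrite normrM (ger0_norm (sqr_ge0 _)) ler_wpM2l// sqr_ge0.
have h5 := ler_normB (g x * s x - beta * g x - sigma ^+ 2 * g1 x) (jump_int s g x).
have h6 := ler_normB (g x * s x - beta * g x) (sigma ^+ 2 * g1 x).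
have h7 := ler_normB (g x * s x) (beta * g x).
lra.
Qed.

Lemma stein_step_cvg M (s_ : nat -> R -> R) s (g_ g1_ : nat -> R -> R) g g1 x :
  (forall n, frequency_step (s_ n)) -> frequency_step s ->
  (forall n, tame M (g_ n)) -> tame M g ->
  (forall u, s_ n u @[n --> \oo] --> s u) ->
  (forall y, g_ n y @[n --> \oo] --> g y) ->
  (forall y, g1_ n y @[n --> \oo] --> g1 y) ->
  stein_step (s_ n) (g_ n) (g1_ n) x @[n --> \oo] --> stein_step s g g1 x.
Proof.
move=> sf_ sf tg_ tg cs cg cg1.
apply: cvgB; last exact: (@jump_int_cvg M).
apply: cvgB; last by apply: cvgM; [exact: cvg_cst|exact: cg1].
apply: cvgB; last by apply: cvgM; [exact: cvg_cst|exact: cg].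
by apply: cvgM; [exact: cg|exact: cs].
Qed.

Definition sin_step h u : R := sin (h * u) / h.

Lemma frequency_step_id : frequency_step id.
Proof.
split=> [|u|u]; [exact: measurable_id|by []|by rewrite subrr normr0 sqr_ge0].
Qed.

Lemma frequency_step_sin h : 0 < h -> h <= 1 -> frequency_step (sin_step h).
Proof.
move=> h0 h1; rewrite /sin_step; split=> [|u|u].
- by measurability.
- rewrite normrM normfV (gtr0_norm h0) ler_pdivrMr// [leRHS]mulrC.
  by apply: le_trans (sin_lipschitz0 _) _; rewrite normrM gtr0_norm.
- have -> : sin (h * u) / h - u = (sin (h * u) - h * u) / h by field; rewrite gt_eqF.
  rewrite normrM normfV (gtr0_norm h0) ler_pdivrMr//.
  apply: le_trans (sin_sub_id_le _) _; rewrite exprMn [leLHS]mulrC ler_wpM2l ?sqr_ge0//.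
  by rewrite expr2 ler_piMl// ltW.
Qed.

Lemma sin_step_le h u : 0 < h -> `|sin_step h u| <= h^-1.
Proof.
move=> h0; rewrite /sin_step normrM normfV (gtr0_norm h0) ler_piMl ?sin_max//.
by rewrite invr_ge0 ltW.
Qed.

Lemma sin_step_cvg (h_ : nat -> R) u : (forall n, 0 < h_ n) ->
  h_ n @[n --> \oo] --> (0 : R) -> sin_step (h_ n) u @[n --> \oo] --> u.
Proof.
move=> h0 ch.
have cb : h_ n * u ^+ 2 @[n --> \oo] --> (0 : R).
  by rewrite -[X in _ --> X](mul0r (u ^+ 2)); apply: cvgM => //; exact: cvg_cst.
have : sin_step (h_ n) u - u @[n --> \oo] --> (0 : R).
  apply/norm_cvg0P; apply: (squeeze_cvgr _ (cvg_cst (0:R)) cb).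
  apply: nearW => n; rewrite normr_ge0/= /sin_step.
  have -> : sin (h_ n * u) / h_ n - u = (sin (h_ n * u) - h_ n * u) / h_ n.
    by field; rewrite gt_eqF.
  rewrite normrM normfV (gtr0_norm (h0 n)) ler_pdivrMr//.
  apply: le_trans (sin_sub_id_le _) _; rewrite exprMn; lra.
move=> /cvgD /(_ (cvg_cst u)); rewrite add0r.
by apply: cvg_trans; apply: near_eq_cvg; apply: nearW => n /=; rewrite subrK.
Qed.

End stein_operator.

(** * Expectation of the stepped operator on waves and their superpositions *)

Section characteristic_waves.
Context (R : realType) (nu : {sigma_finite_measure set (measurableTypeR R) -> \bar R}).
Hypothesis weight_int : nu.-integrable setT (EFin \o @levy_weight R).
Context (beta sigma : R).
Context (d : measure_display) (T : measurableType d) (P : probability T R)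
  (X : T -> R).
Hypothesis mX : measurable_fun setT X.
Hypothesis char_cos : forall z, \int[P]_t cos (z * X t) =
  expR (levy_re nu sigma z) * cos (levy_im nu beta z).
Hypothesis char_sin : forall z, \int[P]_t sin (z * X t) =
  expR (levy_re nu sigma z) * sin (levy_im nu beta z).
Context (h : R).
Hypothesis h0 : 0 < h.
Hypothesis h1 : h <= 1.
Let s := sin_step h.
Implicit Types (z k x u l : R).

Definition wave z k : R -> R := fun x => cos (z * x - k).
Definition dwave z k : R -> R := fun x => - (z * sin (z * x - k)).

Definition drift_coef z : R := \int[nu]_u (cos (u * z) * s u - u * \1_(@small_jump R) u).
Definition diffusion_coef z : R := \int[nu]_u (sin (u * z) * s u).

Let ms : measurable_fun setT s. Proof. by rewrite /s /sin_step; measurability. Qed.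

Lemma wave_jump_le z k l x u : `|z| <= l ->
  `|jump_term s (wave z k) x u| <= (l + 1 + h^-1) * levy_weight u.
Proof.
move=> zl; have [_ s1 s2] := frequency_step_sin h0 h1.
rewrite /jump_term /wave; have hV : 0 <= h^-1 by rewrite invr_ge0 ltW.
have l0 : 0 <= l by rewrite (le_trans _ zl).
have [u1|u1] := leP `|u| 1.
  rewrite levy_weight_small// small_jump_in// mulr1.
  set c' := cos (z * (x + u) - k); set c := cos (z * x - k).
  have -> : c' * s u - u * c = (c' - c) * s u + c * (s u - u) by ring.
  apply: le_trans (ler_normD _ _) _; rewrite (normrM (c' - c)) (normrM c).
  have b1 : `|c' - c| <= l * `|u|.
    apply: le_trans (cos_lipschitz _ _) _.
    have -> : z * (x + u) - k - (z * x - k) = z * u by ring.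
    by rewrite normrM ler_wpM2r.
  have b2 : `|c' - c| * `|s u| <= l * `|u| * `|u| by exact: ler_pM.
  have b3 : `|c| * `|s u - u| <= 1 * u ^+ 2 by apply: ler_pM => //; exact: cos_max.
  have b4 : 0 <= h^-1 * u ^+ 2 by rewrite mulr_ge0// sqr_ge0.
  rewrite -mulrA -expr2 real_normK ?num_real// in b2; lra.
rewrite small_jump_out// mulr0 mul0r subr0 levy_weight_large// mulr1 normrM.
have b1 : `|cos (z * (x + u) - k)| * `|s u| <= 1 * h^-1.
  by apply: ler_pM => //; [exact: cos_max|exact: sin_step_le].
lra.
Qed.

Let drift_le z l u : `|z| <= l ->
  `|cos (u * z) * s u - u * \1_(@small_jump R) u| <= (l + 1 + h^-1) * levy_weight u.
Proof.
move=> /(wave_jump_le 0 0 u); rewrite /jump_term /wave.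
by rewrite !add0r !subr0 mulr0 cos0 mulr1 [z * u]mulrC.
Qed.

Let diffusion_le z l u : `|z| <= l ->
  `|sin (u * z) * s u| <= (l + 1 + h^-1) * levy_weight u.
Proof.
move=> /(wave_jump_le (pi / 2) 0 u); rewrite /jump_term /wave.
rewrite !add0r !mulr0 !sub0r !cosN cos_pihalf mulr0 subr0 [z * u]mulrC.
by rewrite cosBpihalf.
Qed.

Let integrable_drift z : nu.-integrable setT
  (EFin \o (fun u : measurableTypeR R => cos (u * z) * s u - u * \1_(@small_jump R) u)).
Proof.
apply: (integrable_levy weight_int _ (fun u => drift_le u (lexx `|z|))).
by measurability.
Qed.

Let integrable_diffusion z : nu.-integrable setT
  (EFin \o (fun u : measurableTypeR R => sin (u * z) * s u)).
Proof.
apply: (integrable_levy weight_int _ (fun u => diffusion_le u (lexx `|z|))).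
by measurability.
Qed.

Lemma jump_int_wave z k x :
  jump_int nu s (wave z k) x =
  cos (z * x - k) * drift_coef z - sin (z * x - k) * diffusion_coef z.
Proof.
rewrite /drift_coef /diffusion_coef -!RintegralZl//.
rewrite -RintegralB//; [|exact: integrableZ|exact: integrableZ].
apply: eq_RintegralT => u; rewrite /jump_term /wave.
have -> : z * (x + u) - k = (z * x - k) + u * z by ring.
by rewrite cosD; ring.
Qed.

(** The sine step is chosen for this: its jump integral against a wave is exactly a
    symmetric difference of the exponent. *)
Lemma drift_coefE z : 2 * h * (beta + drift_coef z) =
  levy_im nu beta (z + h) - levy_im nu beta (z - h).
Proof.
rewrite /levy_im; have -> (a b c e : R) : a + b - (c + e) = (a - c) + (b - e) by ring.
rewrite -RintegralB//; [|exact: integrable_sin_comp|exact: integrable_sin_comp].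
rewrite mulrDr -RintegralZl//; congr (_ + _); first by ring.
apply: eq_RintegralT => u; rewrite /s /sin_step.
have -> : u * (z + h) = u * z + h * u by ring.
have -> : u * (z - h) = u * z - h * u by ring.
by rewrite sinD sinB; field; rewrite gt_eqF.
Qed.

Lemma diffusion_coefE z : - (2 * h * (sigma ^+ 2 * z + diffusion_coef z)) =
  levy_re nu sigma (z + h) - levy_re nu sigma (z - h).
Proof.
rewrite /levy_re; have -> (a b c e : R) : a + b - (c + e) = (a - c) + (b - e) by ring.
rewrite -RintegralB//; [|exact: integrable_cosB1|exact: integrable_cosB1].
rewrite [X in _ = _ + X](_ : _ = - (2 * h) * diffusion_coef z); first by field.
rewrite -RintegralZl//; apply: eq_RintegralT => u; rewrite /s /sin_step.
have -> : u * (z + h) = u * z + h * u by ring.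
have -> : u * (z - h) = u * z - h * u by ring.
by rewrite cosD cosB; field; rewrite gt_eqF.
Qed.

Lemma stein_waveE z k x :
  stein_step nu beta sigma s (wave z k) (dwave z k) x =
  cos (z * x - k) * (s x - beta - drift_coef z)
  + sin (z * x - k) * (sigma ^+ 2 * z + diffusion_coef z).
Proof. by rewrite /stein_step jump_int_wave /wave /dwave; ring. Qed.

Let integrable_trig (f : T -> R) : measurable_fun setT f -> (forall t, `|f t| <= 1) ->
  P.-integrable setT (EFin \o f).
Proof.
move=> mf f1; apply: (@integrable_dominated _ _ _ _ _ (fun=> 1)) => //.
exact: finite_measure_integrable_cst.
Qed.

Lemma char_cos_phase z k : \int[P]_t cos (z * X t - k) =
  expR (levy_re nu sigma z) * cos (levy_im nu beta z - k).
Proof.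
under eq_RintegralT do rewrite cosB.
have ic : P.-integrable setT (EFin \o (fun t => cos (z * X t))).
  by apply: integrable_trig => [|t]; [measurability|exact: cos_max].
have is' : P.-integrable setT (EFin \o (fun t => sin (z * X t))).
  by apply: integrable_trig => [|t]; [measurability|exact: sin_max].
rewrite RintegralD//; first last.
- by apply: eq_integrable (integrableZ (sin k) is') => // t _ /=; rewrite mulrC.
- by apply: eq_integrable (integrableZ (cos k) ic) => // t _ /=; rewrite mulrC.
by rewrite !RintegralZr// char_cos char_sin cosB; ring.
Qed.

Lemma char_sin_phase z k : \int[P]_t sin (z * X t - k) =
  expR (levy_re nu sigma z) * sin (levy_im nu beta z - k).
Proof.
have := char_cos_phase z (k + pi / 2).
by under eq_RintegralT do rewrite opprD addrA cosBpihalf; rewrite opprD addrA cosBpihalf.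
Qed.

(** Both sides expand in the values of e^A sin(B - k) at z + h and z - h; the
    first-order terms of the two remainders reproduce the drift, diffusion and jump
    terms by [drift_coefE] and [diffusion_coefE]. *)
Lemma expect_stein_wave z k :
  2 * h * (\int[P]_t stein_step nu beta sigma s (wave z k) (dwave z k) (X t)) =
  expR (levy_re nu sigma z) *
  (exp_sin_remainder (levy_re nu sigma (z + h) - levy_re nu sigma z)
     (levy_im nu beta (z + h) - levy_im nu beta z) (levy_im nu beta z - k) -
   exp_sin_remainder (levy_re nu sigma (z - h) - levy_re nu sigma z)
     (levy_im nu beta (z - h) - levy_im nu beta z) (levy_im nu beta z - k)).
Proof.
set A := levy_re nu sigma; set B := levy_im nu beta; set th := B z - k.
pose D := B (z + h) - B (z - h); pose E := A (z + h) - A (z - h).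
have -> : \int[P]_t stein_step nu beta sigma s (wave z k) (dwave z k) (X t) =
  \int[P]_t ((2 * h)^-1 * (sin ((z + h) * X t - k) - sin ((z - h) * X t - k))
     - (2 * h)^-1 * (D * cos (z * X t - k) + E * sin (z * X t - k))).
  apply: eq_RintegralT => t; rewrite stein_waveE.
  rewrite /D /E /B /A -drift_coefE -diffusion_coefE /s /sin_step.
  have -> : (z + h) * X t - k = (z * X t - k) + h * X t by ring.
  have -> : (z - h) * X t - k = (z * X t - k) - h * X t by ring.
  by move: (z * X t - k) => y; rewrite sinD sinB; field; rewrite gt_eqF.
have isin y : P.-integrable setT (EFin \o (fun t => sin (y * X t - k))).
  by apply: integrable_trig => [|t]; [measurability|exact: sin_max].
have icos y : P.-integrable setT (EFin \o (fun t => cos (y * X t - k))).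
  by apply: integrable_trig => [|t]; [measurability|exact: cos_max].
rewrite RintegralB//; first last.
- by do ?[apply: integrableZ|apply: integrableD_real].
- by apply: integrableZ; apply: integrableB_real.
rewrite !RintegralZl//; first last.
- by apply: integrableB_real.
- by do ?[apply: integrableZ|apply: integrableD_real].
rewrite RintegralB// RintegralD//; [|exact: integrableZ|exact: integrableZ].
rewrite !RintegralZl// !char_sin_phase char_cos_phase -/A -/B.
have -> a b : 2 * h * ((2 * h)^-1 * a - (2 * h)^-1 * b) = a - b.
  by field; rewrite gt_eqF.
have eA y : expR (A y) = expR (A z) * expR (A y - A z).
  by rewrite -expRD addrC subrK.
have eB y : B y - k = th + (B y - B z) by rewrite /th; ring.
rewrite (eA (z + h)) (eA (z - h)) (eB (z + h)) (eB (z - h)) /exp_sin_remainder /D /E -/th.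
by ring.
Qed.

Section superposition.
Context (dO : measure_display) (O : measurableType dO)
  (m : {sigma_finite_measure set O -> \bar R}) (w zf kf : O -> R) (l : R).
Hypothesis wi : m.-integrable setT (EFin \o w).
Hypothesis mz : measurable_fun setT zf.
Hypothesis mk : measurable_fun setT kf.
Hypothesis wl : forall o, w o != 0 -> `|zf o| <= l.
Hypothesis l0 : 0 <= l.

(** The index space is arbitrary: it will be the plane, with one coordinate for the
    frequency and one for the integration variable of a convolution. *)
Definition superpose x : R := \int[m]_o (w o * wave (zf o) (kf o) x).
Definition dsuperpose x : R := \int[m]_o (w o * dwave (zf o) (kf o) x).

Let mw : measurable_fun setT w. Proof. exact: integrable_measurable wi. Qed.
Let C := l + 1 + h^-1.
Let wai : m.-integrable setT (EFin \o (fun o => `|w o|)).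
Proof.
apply: integrable_dominated (integrable_abse wi) _ => //.
  exact: measurable_norm_comp.
by move=> o; rewrite normr_id.
Qed.

Let integrable_w (f : O -> R) (B : R) : measurable_fun setT (fun o => w o * f o) ->
  (forall o, `|zf o| <= l -> `|f o| <= B) ->
  m.-integrable setT (EFin \o (fun o => w o * f o)).
Proof.
move=> mf fB; apply: integrable_dominated (integrableZ B wai) _ => // o.
have [->|w0] := eqVneq (w o) 0; first by rewrite mul0r normr0 mulr0.
by rewrite normrM mulrC ler_wpM2r// fB// wl.
Qed.

Let w_le u o (y : R) : (`|zf o| <= l -> `|y| <= C * levy_weight u) ->
  `|w o * y| <= levy_weight u * (C * `|w o|).
Proof.
have [->|w0] := eqVneq (w o) 0; first by rewrite mul0r normr0 !mulr0.
move=> yC; rewrite normrM mulrC mulrA [_ * C]mulrC ler_wpM2r//.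
by apply: yC; exact: wl.
Qed.

Let wdrift_le u o :
  `|w o * (cos (u * zf o) * s u - u * \1_(@small_jump R) u)| <=
  levy_weight u * (C * `|w o|).
Proof. by apply: w_le => zl; exact: drift_le. Qed.

Let wdiffusion_le u o :
  `|w o * (sin (u * zf o) * s u)| <= levy_weight u * (C * `|w o|).
Proof. by apply: w_le => zl; exact: diffusion_le. Qed.

Let wjump_le x u o :
  `|w o * jump_term s (wave (zf o) (kf o)) x u| <= levy_weight u * (C * `|w o|).
Proof. by apply: w_le => zl; exact: wave_jump_le. Qed.

Let measurable_wdrift : measurable_fun setT (fun o => w o * drift_coef (zf o)).
Proof.
have mf : measurable_fun (T := (measurableTypeR R * O)%type) setT (fun p =>
    w p.2 * (cos (p.1 * zf p.2) * s p.1 - p.1 * \1_(@small_jump R) p.1)).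
  by measurability.
have := integrable_Rintegral2 mf weight_int (integrableZ C wai) wdrift_le.
move=> /integrable_measurable; apply: eq_measurable_fun => o _ /=.
by rewrite RintegralZl//; exact: integrable_drift.
Qed.

Let measurable_wdiffusion : measurable_fun setT (fun o => w o * diffusion_coef (zf o)).
Proof.
have mf : measurable_fun (T := (measurableTypeR R * O)%type) setT (fun p =>
    w p.2 * (sin (p.1 * zf p.2) * s p.1)).
  by measurability.
have := integrable_Rintegral2 mf weight_int (integrableZ C wai) wdiffusion_le.
move=> /integrable_measurable; apply: eq_measurable_fun => o _ /=.
by rewrite RintegralZl//; exact: integrable_diffusion.
Qed.

Let integrable_wave_jump z k x : nu.-integrable setT (EFin \o jump_term s (wave z k) x).
Proof.
apply: (integrable_levy weight_int _ (fun u => wave_jump_le k x u (lexx `|z|))).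
by rewrite /jump_term /wave; measurability.
Qed.

Lemma integrable_wave x : m.-integrable setT
  (EFin \o (fun o => w o * wave (zf o) (kf o) x)).
Proof.
apply: (@integrable_w _ 1); last by move=> o _; exact: cos_max.
by rewrite /wave; measurability.
Qed.

Lemma integrable_dwave x : m.-integrable setT
  (EFin \o (fun o => w o * dwave (zf o) (kf o) x)).
Proof.
apply: (@integrable_w _ l); first by rewrite /dwave; measurability.
move=> o zl; rewrite /dwave normrN normrM -[leRHS]mulr1.
by apply: ler_pM => //; exact: sin_max.
Qed.

Lemma jump_int_superpose x :
  jump_int nu s superpose x = \int[m]_o (w o * jump_int nu s (wave (zf o) (kf o)) x).
Proof.
pose f (p : measurableTypeR R * O) := w p.2 * jump_term s (wave (zf p.2) (kf p.2)) x p.1.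
have mf : measurable_fun setT f by rewrite /f /jump_term /wave; measurability.
have F := Rintegral_fubini mf weight_int (integrableZ C wai) (wjump_le x).
transitivity (\int[m]_o \int[nu]_u f (u, o)); last first.
  by apply: eq_RintegralT => o; rewrite /f/= RintegralZl.
rewrite -F; apply: eq_RintegralT => u; rewrite /f/= /jump_term /superpose.
rewrite -RintegralZr; [|by []|exact: integrable_wave].
rewrite -RintegralZl; [|by []|exact: integrable_wave].
rewrite -RintegralB//; first by apply: eq_RintegralT => o; ring.
  apply: eq_integrable (integrableZ (s u) (integrable_wave (x + u))) => //.
  by move=> o _ /=; rewrite mulrC.
by apply: integrableZ; exact: integrable_wave.
Qed.

Lemma integrable_wave_jump_int x : m.-integrable setT
  (EFin \o (fun o => w o * jump_int nu s (wave (zf o) (kf o)) x)).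
Proof.
apply: (@integrable_w _ (C * levy_mass nu)).
  under eq_fun do rewrite jump_int_wave mulrBr ![w _ * (_ * _)]mulrCA.
  by measurability.
move=> o zl; apply: Rintegral_levy_le => //.
  by rewrite /jump_term /wave; measurability.
by move=> u; exact: wave_jump_le.
Qed.

Lemma stein_step_superpose x :
  stein_step nu beta sigma s superpose dsuperpose x =
  \int[m]_o (w o * stein_step nu beta sigma s (wave (zf o) (kf o)) (dwave (zf o) (kf o)) x).
Proof.
have iw := integrable_wave x; have idw := integrable_dwave x.
have ij := integrable_wave_jump_int x.
have e o : w o * stein_step nu beta sigma s (wave (zf o) (kf o)) (dwave (zf o) (kf o)) x =
  (s x - beta) * (w o * wave (zf o) (kf o) x) -
  sigma ^+ 2 * (w o * dwave (zf o) (kf o) x) -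
  w o * jump_int nu s (wave (zf o) (kf o)) x by rewrite /stein_step; ring.
rewrite (eq_RintegralT _ e).
rewrite RintegralB//; last by apply: integrableB_real; exact: integrableZ.
rewrite RintegralB//; [|exact: integrableZ|exact: integrableZ].
rewrite !RintegralZl// /stein_step jump_int_superpose /superpose /dsuperpose.
by ring.
Qed.

Let K := h^-1 + `|beta| + C * levy_mass nu + (sigma ^+ 2 * l + C * levy_mass nu).

Let stein_wave_le t o : `|w o * stein_step nu beta sigma s (wave (zf o) (kf o))
    (dwave (zf o) (kf o)) (X t)| <= K * `|w o|.
Proof.
have [->|w0] := eqVneq (w o) 0; first by rewrite mul0r normr0 mulr0.
rewrite normrM mulrC ler_wpM2r// stein_waveE; have zl := wl w0.
have c1 := cos_max (zf o * X t - kf o); have s1 := sin_max (zf o * X t - kf o).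
have dr : `|drift_coef (zf o)| <= C * levy_mass nu.
  apply: Rintegral_levy_le => //; first by measurability.
  by move=> u; exact: drift_le.
have df : `|diffusion_coef (zf o)| <= C * levy_mass nu.
  apply: Rintegral_levy_le => //; first by measurability.
  by move=> u; exact: diffusion_le.
have hs := sin_step_le (X t) h0.
apply: le_trans (ler_normD _ _) _; rewrite (normrM (cos _)) (normrM (sin _)).
apply: lerD.
  rewrite -[leRHS]mul1r; apply: ler_pM => //.
  apply: le_trans (ler_normB _ _) _; apply: lerD => //.
  by apply: le_trans (ler_normB _ _) _; apply: lerD.
rewrite -[leRHS]mul1r; apply: ler_pM => //.
apply: le_trans (ler_normD _ _) _; apply: lerD => //.
by rewrite normrM (ger0_norm (sqr_ge0 _)) ler_wpM2l// sqr_ge0.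
Qed.

Let F (p : T * O) := w p.2 * stein_step nu beta sigma s (wave (zf p.2) (kf p.2))
    (dwave (zf p.2) (kf p.2)) (X p.1).

Let mF : measurable_fun setT F.
Proof.
rewrite /F; have e (p : T * O) : w p.2 * stein_step nu beta sigma s (wave (zf p.2) (kf p.2))
    (dwave (zf p.2) (kf p.2)) (X p.1) =
  cos (zf p.2 * X p.1 - kf p.2) * (w p.2 * (s (X p.1) - beta) - w p.2 * drift_coef (zf p.2))
  + sin (zf p.2 * X p.1 - kf p.2) *
   (sigma ^+ 2 * (w p.2 * zf p.2) + w p.2 * diffusion_coef (zf p.2)).
  by rewrite stein_waveE; ring.
under eq_fun do rewrite e.
have md := measurableT_comp measurable_wdrift (@measurable_snd _ _ T O).
have mdf := measurableT_comp measurable_wdiffusion (@measurable_snd _ _ T O).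
by measurability.
Qed.

Let constK : P.-integrable setT (EFin \o (fun=> K)).
Proof. exact: finite_measure_integrable_cst. Qed.

(** Measurability in t is a by-product of Fubini's theorem for the superposition
    integral. *)
Lemma measurable_stein_superpose :
  measurable_fun setT (fun t => stein_step nu beta sigma s superpose dsuperpose (X t)).
Proof.
have := integrable_Rintegral1 mF constK wai stein_wave_le.
move=> /integrable_measurable; apply: eq_measurable_fun => t _ /=.
by rewrite stein_step_superpose.
Qed.

(** Fubini's theorem moves the expectation inside the superposition. *)
Lemma expect_stein_superpose_le r :
  (forall z k, `|z| <= l ->
    `|\int[P]_t stein_step nu beta sigma s (wave z k) (dwave z k) (X t)| <= r) ->
  `|\int[P]_t stein_step nu beta sigma s superpose dsuperpose (X t)| <=
  r * \int[m]_o `|w o|.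
Proof.
move=> hr; have E := Rintegral_fubini mF constK wai stein_wave_le.
have -> : \int[P]_t stein_step nu beta sigma s superpose dsuperpose (X t) =
    \int[P]_t \int[m]_o F (t, o).
  by apply: eq_RintegralT => t; rewrite stein_step_superpose.
rewrite E -RintegralZl//; apply: Rintegral_norm_le.
- exact/integrable_measurable/(integrable_Rintegral2 mF constK wai stein_wave_le).
- exact: integrableZ.
- move=> o; rewrite /F/=.
  have [->|w0] := eqVneq (w o) 0.
    under eq_RintegralT do rewrite mul0r.
    by rewrite Rintegral_cst// mul0r normr0 mulr0.
  rewrite RintegralZl//.
    by rewrite normrM mulrC ler_wpM2r// hr// wl.
  have i1 := integrable_section2 mF constK stein_wave_le o.
  apply: eq_integrable (integrableZ (w o)^-1 i1) => // t _ /=.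
  by rewrite /F/= mulKf.
Qed.

End superposition.

End characteristic_waves.

(** * Letting the step tend to zero *)

Section vanishing_step.
Context (R : realType) (nu : {sigma_finite_measure set (measurableTypeR R) -> \bar R}).
Hypothesis weight_int : nu.-integrable setT (EFin \o @levy_weight R).
Context (beta sigma : R).
Context (d : measure_display) (T : measurableType d) (P : probability T R)
  (X : T -> R).
Hypothesis mX : measurable_fun setT X.
Hypothesis char_cos : forall z, \int[P]_t cos (z * X t) =
  expR (levy_re nu sigma z) * cos (levy_im nu beta z).
Hypothesis char_sin : forall z, \int[P]_t sin (z * X t) =
  expR (levy_re nu sigma z) * sin (levy_im nu beta z).
Hypothesis osc_o : forall e : R, 0 < e ->
  exists2 dl : R, 0 < dl & forall h, 0 < h -> h < dl -> levy_osc nu h <= e * h.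
Implicit Types (z k x u l h e : R).

Definition wave_const l : R :=
  `|beta| + 2 * (l + 1) * (sigma ^+ 2 + levy_mass nu) + levy_mass nu + 2.

Let N0 : 0 <= levy_mass nu. Proof. exact: levy_mass_ge0. Qed.

Lemma wave_const_gt0 l : 0 <= l -> 0 < wave_const l.
Proof.
move=> l0; rewrite /wave_const ltr_wpDl// addr_ge0// addr_ge0// mulr_ge0//.
  by rewrite mulr_ge0// addr_ge0.
by rewrite addr_ge0// sqr_ge0.
Qed.

(** With h = t^2, the small jumps, the drift and the Gaussian part contribute
    O(t^2), and the Cauchy-Schwarz bound with parameter e t contributes O(e t),
    since levy_osc h <= e^2 h. *)
Lemma levy_increment_le l z h dz e t : 0 <= l -> `|z| <= l -> h <= 1 -> 0 < e -> 0 < t ->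
  t <= e -> h = t ^+ 2 -> levy_osc nu h <= e ^+ 2 * h -> dz = h \/ dz = - h ->
  `|levy_re nu sigma (z + dz) - levy_re nu sigma z| <= t * (e * wave_const l) /\
  `|levy_im nu beta (z + dz) - levy_im nu beta z| <= t * (e * wave_const l).
Proof.
move=> l0 zl h1 e0 t0 te hE hosc dzE.
have h0 : 0 < h by rewrite hE exprn_gt0.
have dzh : `|dz| = h by case: dzE => ->; rewrite ?normrN gtr0_norm.
have Qdz : levy_large_osc nu dz = levy_large_osc nu h.
  by case: dzE => ->//; rewrite levy_large_oscN.
have Q : levy_large_osc nu h <= t * (e * (levy_mass nu + 2)).
  have et0 : 0 < e * t by rewrite mulr_gt0.
  apply: le_trans (levy_large_osc_le weight_int h et0) _.
  have : 2 / (e * t) * levy_osc nu h <= 2 / (e * t) * (e ^+ 2 * h).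
    by rewrite ler_wpM2l// divr_ge0// ltW.
  have -> : 2 / (e * t) * (e ^+ 2 * h) = 2 * (e * t).
    by rewrite hE; field; rewrite !gt_eqF.
  lra.
have zl1 : `|z| + `|dz| <= l + 1 by rewrite dzh lerD.
have aux y : 0 <= y -> h * y <= t * (e * y).
  by move=> y0; rewrite hE expr2 -mulrA ler_wpM2l ?ler_wpM2r// ltW.
split.
  apply: le_trans (levy_re_increment weight_int sigma zl1) _.
  rewrite dzh Qdz.
  have := aux (2 * (l + 1) * (sigma ^+ 2 + levy_mass nu)).
  rewrite mulr_ge0 ?mulr_ge0 ?addr_ge0 ?sqr_ge0// => /(_ isT).
  have : 0 <= t * (e * `|beta|) by rewrite !mulr_ge0// ltW.
  rewrite /wave_const; lra.
apply: le_trans (levy_im_increment weight_int beta zl1) _.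
rewrite dzh Qdz.
have := aux (`|beta| + 2 * (l + 1) * levy_mass nu).
rewrite addr_ge0 ?mulr_ge0 ?addr_ge0// => /(_ isT).
have : 0 <= t * (e * (2 * (l + 1) * sigma ^+ 2)).
  by do ?[exact: sqr_ge0|exact: ltW|apply: mulr_ge0|apply: addr_ge0|done].
rewrite /wave_const; lra.
Qed.

(** The remainders of [expect_stein_wave] are O((e t)^2) = O(e^2 h), and they are
    divided by 2h. *)
Lemma wave_error l e : 0 <= l -> 0 < e -> e <= 1 ->
  exists h, [/\ 0 < h, h <= e & forall z k, `|z| <= l ->
    `|\int[P]_t stein_step nu beta sigma (sin_step h) (wave z k) (dwave z k) (X t)|
      <= 6 * (e * wave_const l) ^+ 2].
Proof.
move=> l0 e0 e1; have D0 := wave_const_gt0 l0.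
have [dl dl0 Hdl] := osc_o (exprn_gt0 2 e0).
(* t <= e absorbs the O(t^2) terms, t <= dl/2 makes h = t^2 < dl, and the last
   bound keeps the increments of A below 1/2, where the Taylor bound applies *)
pose t := Num.min e (Num.min (dl / 2) (2 * wave_const l)^-1).
have t0 : 0 < t by rewrite !lt_min e0 divr_gt0//= invr_gt0 mulr_gt0.
have te : t <= e by rewrite ge_min lexx.
have tdl : t <= dl / 2 by rewrite !ge_min lexx !orbT.
have tD : t <= (2 * wave_const l)^-1 by rewrite !ge_min lexx !orbT.
have t1 : t <= 1 by exact: le_trans te e1.
have tt : t ^+ 2 <= t by rewrite expr2 ler_piMl// ltW.
have h0 : 0 < t ^+ 2 by rewrite exprn_gt0.
have h1 : t ^+ 2 <= 1 by exact: le_trans tt t1.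
have hosc : levy_osc nu (t ^+ 2) <= e ^+ 2 * t ^+ 2.
  by apply: Hdl => //; apply: le_lt_trans tt _; lra.
exists (t ^+ 2); split=> //; first exact: le_trans tt te.
move=> z k zl.
have := expect_stein_wave weight_int mX char_cos char_sin h0 h1 z k.
set E := \int[P]_t _; set a1 := levy_re _ _ (z + _) - _; set b1 := levy_im _ _ (z + _) - _.
set a2 := levy_re _ _ (z - _) - _; set b2 := levy_im _ _ (z - _) - _ => hE.
have [ha1 hb1] := levy_increment_le l0 zl h1 e0 t0 te erefl hosc (or_introl erefl).
have [ha2 hb2] := levy_increment_le l0 zl h1 e0 t0 te erefl hosc (or_intror erefl).
rewrite -/a1 -/b1 -/a2 -/b2 in ha1 hb1 ha2 hb2.
have half : t * (e * wave_const l) <= 1 / 2.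
  apply: (@le_trans _ _ (t * (1 * wave_const l))).
    by rewrite ler_wpM2l ?ler_wpM2r// ltW.
  rewrite mul1r -ler_pdivlMr//; apply: le_trans tD _.
  by rewrite invfM div1r.
have sq x : `|x| <= t * (e * wave_const l) -> x ^+ 2 <= t ^+ 2 * (e * wave_const l) ^+ 2.
  by move=> xt; rewrite -exprMn -(real_normK (num_real x)) lerXn2r// nnegrE// (le_trans _ xt).
have r1 := exp_sin_remainder_le b1 (levy_im nu beta z - k) (le_trans ha1 half).
have r2 := exp_sin_remainder_le b2 (levy_im nu beta z - k) (le_trans ha2 half).
move: r1 r2 hE; set r1 := exp_sin_remainder _ _ _; set r2 := exp_sin_remainder _ _ _.
move=> hr1 hr2 hE.
have A1 : expR (levy_re nu sigma z) <= 1.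
  rewrite -expR0 ler_expR levy_reE// -opprD oppr_le0 addr_ge0 ?levy_osc_ge0//.
  by rewrite divr_ge0// mulr_ge0// sqr_ge0.
have : `|2 * t ^+ 2 * E| <= 1 * (`|r1| + `|r2|).
  rewrite hE normrM; apply: ler_pM => //; last exact: ler_normB.
  by rewrite ger0_norm// expR_ge0.
rewrite normrM (@ger0_norm _ (2 * t ^+ 2)); last by rewrite mulr_ge0// ltW.
move=> H; rewrite -(ler_pM2l h0).
have := sq _ ha1; have := sq _ ha2; have := sq _ hb1; have := sq _ hb2.
lra.
Qed.

Section superposed.
Context (dO : measure_display) (O : measurableType dO)
  (m : {sigma_finite_measure set O -> \bar R}) (w zf kf : O -> R) (l : R).
Hypothesis wi : m.-integrable setT (EFin \o w).
Hypothesis mz : measurable_fun setT zf.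
Hypothesis mk : measurable_fun setT kf.
Hypothesis wl : forall o, w o != 0 -> `|zf o| <= l.
Hypothesis l0 : 0 <= l.
Context (K M : R).
Hypothesis tail : forall x, `|x| * (\int[nu]_u far_jump x u) <= K.
Let g := superpose m w zf kf.
Let g1 := dsuperpose m w zf kf.
Hypothesis tg : tame M g.
Hypothesis g1M : forall x, `|g1 x| <= M.

(** For the step of [wave_error] with e = 1/(n+1) the expectation tends to 0 by the
    bound there, and to the expectation for the identity step by dominated
    convergence. *)
Lemma stein_superpose_eq0 :
  measurable_fun setT (fun t => stein_step nu beta sigma id g g1 (X t)) /\
  \int[P]_t stein_step nu beta sigma id g g1 (X t) = 0.
Proof.
have e0 n : 0 < (n.+1%:R : R)^-1 by rewrite invr_gt0.
have e1 n : (n.+1%:R : R)^-1 <= 1 by rewrite invf_le1// ler1n.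
have [h_ Hh] := choice (fun n => wave_error l0 (e0 n) (e1 n)).
have h0 n : 0 < h_ n by have [] := Hh n.
have he n : h_ n <= (n.+1%:R)^-1 by have [] := Hh n.
have h1 n : h_ n <= 1 by exact: le_trans (he n) (e1 n).
have ce : (n.+1%:R : R)^-1 @[n --> \oo] --> (0 : R) by exact: cvg_harmonic.
have ch : h_ n @[n --> \oo] --> (0 : R).
  apply: (squeeze_cvgr _ (cvg_cst (0:R)) ce); apply: nearW => n.
  by rewrite ltW//= he.
pose s_ n := sin_step (h_ n).
have sf n : frequency_step (s_ n) by exact: frequency_step_sin.
have mD n : measurable_fun setT (fun t => stein_step nu beta sigma (s_ n) g g1 (X t)).
  exact: (@measurable_stein_superpose _ nu weight_int beta sigma _ _ P X mX
    (h_ n) (h0 n) (h1 n) _ _ m w zf kf l wi mz mk wl).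
have cD t : stein_step nu beta sigma (s_ n) g g1 (X t) @[n --> \oo] -->
    stein_step nu beta sigma id g g1 (X t).
  apply: (@stein_step_cvg _ nu weight_int beta sigma M s_ id (fun=> g) (fun=> g1)) => //.
  - exact: frequency_step_id.
  - by move=> u; exact: sin_step_cvg.
  - by move=> y; exact: cvg_cst.
  - by move=> y; exact: cvg_cst.
have mlim : measurable_fun setT (fun t => stein_step nu beta sigma id g g1 (X t)).
  by apply: (measurable_fun_cvg (h := fun n t => stein_step nu beta sigma (s_ n) g g1 (X t))).
split=> //.
pose B := M * (1 + `|beta| + sigma ^+ 2 + (3 * levy_mass nu + K)).
have cE : \int[P]_t stein_step nu beta sigma (s_ n) g g1 (X t) @[n --> \oo] -->
    \int[P]_t stein_step nu beta sigma id g g1 (X t).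
  apply: (@Rintegral_dominated_cvg _ _ _ _ _ _ (fun=> B)) => //.
    exact: finite_measure_integrable_cst.
  by move=> n t; apply: stein_step_le.
have c0 : \int[P]_t stein_step nu beta sigma (s_ n) g g1 (X t) @[n --> \oo] --> (0 : R).
  apply/norm_cvg0P.
  pose D := wave_const l; pose W := \int[m]_o `|w o|.
  have cb : 6 * ((n.+1%:R : R)^-1 * D) ^+ 2 * W @[n --> \oo] --> (0 : R).
    have c1 : (n.+1%:R : R)^-1 * D @[n --> \oo] --> (0 : R).
      by rewrite -[X in _ --> X](mul0r D); apply: cvgM => //; exact: cvg_cst.
    have c2 : 6 * ((n.+1%:R : R)^-1 * D * ((n.+1%:R : R)^-1 * D)) * W @[n --> \oo]
        --> 6 * (0 * 0) * W.
      apply: cvgM; last exact: cvg_cst.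
      by apply: cvgM; [exact: cvg_cst|exact: cvgM].
    rewrite !mulr0 mul0r in c2; apply: cvg_trans c2; apply: near_eq_cvg.
    by apply: nearW => n; rewrite expr2.
  apply: (squeeze_cvgr _ (cvg_cst (0:R)) cb); apply: nearW => n.
  rewrite normr_ge0/=.
  apply: (@expect_stein_superpose_le _ nu weight_int beta sigma _ _ P X mX
    (h_ n) (h0 n) (h1 n) _ _ m w zf kf l wi mz mk wl).
  by have [_ _] := Hh n.
exact: (cvg_unique _ cE c0).
Qed.

End superposed.
End vanishing_step.

(** * Integrals over the real line *)

Section line_integrals.
Context (R : realType).
Notation mu := (@lebesgue_measure R).
Implicit Types (f F G : R -> R) (x a l : R).

Lemma ge0_integral_affine G x l : 0 < l -> continuous G -> (forall y, 0 <= G y) ->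
  (\int[mu]_y (G y)%:E = \int[mu]_y (G (x + y / l) / l)%:E)%E.
Proof.
move=> l0 cG G0; pose A : R -> R := fun y => x + y / l.
have dA (y : R) : is_derive y 1 A l^-1.
  rewrite /A; apply: is_derive_eq.
  by rewrite ?(scaler0,add0r,scaler1) div1r.
have A' : (A^`())%classic = fun=> l^-1.
  by apply/funext => y; rewrite derive1E; exact: derive_val.
rewrite (@increasing_ge0_integration_by_substitutionT _ A)//.
- by apply: eq_integral => y _; rewrite A'.
- by move=> y z yz; rewrite /A ltrD2l ltr_pM2r// invr_gt0.
- by rewrite A' => y; exact: cvg_cst.
- by rewrite A'; exact: is_cvg_cst.
- by rewrite A'; exact: is_cvg_cst.
- apply/cvgrNyPle => B; near=> y.
  have : y <= (B - x) * l by near: y; apply: nbhs_ninfty_le; exact: num_real.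
  by rewrite -ler_pdivrMr// /A; lra.
- apply/cvgryPge => B; near=> y.
  have : (B - x) * l <= y by near: y; apply: nbhs_pinfty_ge; exact: num_real.
  by rewrite -ler_pdivlMr// /A; lra.
Unshelve. all: by end_near. Qed.

Lemma continuous_affine x l : continuous (fun y : R => x + y / l).
Proof.
move=> y; apply: cvgD; first exact: cvg_cst.
by apply: cvgM; [exact: cvg_id|exact: cvg_cst].
Qed.

Lemma continuous_comp_affine G x l : continuous G ->
  continuous (fun y : R => G (x + y / l)).
Proof.
move=> cG y.
exact: (@continuous_comp R R R (fun y => x + y / l) G y (@continuous_affine x l y) (cG _)).
Qed.

Lemma integrable_comp_affine G x l : 0 < l -> continuous G ->
  mu.-integrable setT (EFin \o (G : measurableTypeR R -> R)) ->
  mu.-integrable setT (EFin \o (fun y : measurableTypeR R => G (x + y / l))).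
Proof.
move=> l0 cG iG.
have mG' : measurable_fun setT (fun y : R => G (x + y / l)).
  by apply: continuous_measurable_fun; exact: continuous_comp_affine.
pose H : measurableTypeR R -> R := fun y => l^-1 * G (x + y / l).
suff : mu.-integrable setT (EFin \o H).
  move=> /(integrableZ l); apply: eq_integrable => // y _ /=.
  by rewrite mulrA mulfV ?mul1r// gt_eqF.
apply/integrableP; split.
  by apply/measurable_EFinP; apply: measurable_mul => //; exact: measurable_cst_real.
have -> : (\int[mu]_y `|(EFin \o H) y| =
    \int[mu]_y (`|G (x + y / l)%R| / l)%:E)%E.
  apply: eq_integral => y _ /=.
  by rewrite /H normrM mulrC (@ger0_norm _ l^-1)// invr_ge0 ltW.
rewrite -(ge0_integral_affine (G := fun y => `|G y|))//.
  by case/integrableP : iG.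
by move=> y; apply: cvg_norm; exact: cG.
Qed.

(** The nonnegative case is applied to |G| and |G| + G. *)
Lemma Rintegral_affine G x l : 0 < l -> continuous G ->
  mu.-integrable setT (EFin \o (G : measurableTypeR R -> R)) ->
  \int[mu]_y G y = l^-1 * \int[mu]_y G (x + y / l).
Proof.
move=> l0 cG iG.
(* the nonnegative case, from which the general one follows by linearity *)
have ge0 (H : R -> R) : continuous H -> (forall y, 0 <= H y) ->
    mu.-integrable setT (EFin \o (H : measurableTypeR R -> R)) ->
    \int[mu]_y H y = l^-1 * \int[mu]_y H (x + y / l).
  move=> cH H0 iH; rewrite -RintegralZl//; last exact: integrable_comp_affine.
  congr fine; rewrite (ge0_integral_affine x l0 cH H0).
  by apply: eq_integral => y _; rewrite mulrC.
have cN : continuous (fun y : R => `|G y|) by move=> y; apply: cvg_norm; exact: cG.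
have cS : continuous (fun y : R => `|G y| + G y) by move=> y; apply: cvgD; [exact: cN|exact: cG].
have iN : mu.-integrable setT (EFin \o ((fun y => `|G y|) : measurableTypeR R -> R)).
  exact: integrable_abse iG.
have iS : mu.-integrable setT (EFin \o ((fun y => `|G y| + G y) : measurableTypeR R -> R)).
  exact: integrableD_real.
have S0 y : 0 <= `|G y| + G y by have := ler_norm (- G y); rewrite normrN; lra.
have -> : \int[mu]_y G y = \int[mu]_y (`|G y| + G y) - \int[mu]_y `|G y|.
  by rewrite -RintegralB//; apply: eq_RintegralT => y; rewrite addrAC subrr add0r.
rewrite (ge0 _ cS S0 iS) (ge0 _ cN _ iN)// -mulrBr -RintegralB//.
- by congr (_ * _); apply: eq_RintegralT => y; rewrite addrAC subrr add0r.
- exact: (integrable_comp_affine x l0 cS iS).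
- exact: (integrable_comp_affine x l0 cN iN).
Qed.

Lemma integrable_oneDsqrV :
  mu.-integrable setT (EFin \o ((fun y => (1 + y ^+ 2)^-1) : measurableTypeR R -> R)).
Proof.
have ge0 y : 0 <= (1 + y ^+ 2 : R)^-1 by rewrite invr_ge0 addr_ge0// sqr_ge0.
apply/integrableP; split.
  by apply/measurable_EFinP; exact: (continuous_measurable_fun (@continuous_oneDsqrV R)).
under eq_integral do rewrite /= ger0_norm//.
rewrite (@ge0_symfun_integralT _ (fun y => (oneDsqr y)^-1))//.
- rewrite (_ : [set x | 0 <= x] = `[0%R, +oo[%classic); last by rewrite -set_itvcy.
  by rewrite integral0y_oneDsqr -EFinM ltry.
- exact: (@continuous_oneDsqrV R).
- by move=> y; rewrite /oneDsqr /= sqrrN.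
Qed.

(** The integral over [-n, n] is F(n) - F(-n). *)
Lemma integral_derivative_eq0 f F (B : R) : continuous f ->
  mu.-integrable setT (EFin \o (f : measurableTypeR R -> R)) ->
  (forall x : R, is_derive x 1 F (f x)) -> (forall x, `|F x| <= B / (1 + x ^+ 2)) ->
  \int[mu]_x f x = 0.
Proof.
move=> cf fi dF FB.
pose I n : set R := `[- (n.+1%:R), n.+1%:R]%classic.
have E n : \int[mu]_x (\1_(I n) x * f x) = F n.+1%:R - F (- n.+1%:R).
  rewrite Rintegral_indic (Rintegral_FTC _ cf dF)//.
  by rewrite (@le_trans _ _ 0)// oppr_le0.
have c1 : \int[mu]_x (\1_(I n) x * f x) @[n --> \oo] --> \int[mu]_x f x.
  apply: (@Rintegral_dominated_cvg _ _ _ mu _ _ (fun x : measurableTypeR R => `|f x|)).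
  - move=> n; apply: measurable_mul; first by apply: measurable_indic; exact: measurable_itv.
    exact: continuous_measurable_fun.
  - exact: continuous_measurable_fun.
  - exact: integrable_abse fi.
  - move=> n x; rewrite normrM ler_piMl// indicE ger0_norm// lern1 leq_b1//.
  - move=> x; apply: cvg_near_cst.
    near=> n; rewrite indicE mem_set ?mul1r// /I /= in_itv/= -ler_norml.
    apply: (@le_trans _ _ n%:R); last by rewrite ler_nat.
    near: n; exact: nbhs_infty_ger.
have c0 : F n.+1%:R - F (- n.+1%:R) @[n --> \oo] --> (0 : R).
  have ce : (n.+1%:R : R)^-1 @[n --> \oo] --> (0 : R) by exact: cvg_harmonic.
  have cb : 2 * B * (n.+1%:R : R)^-1 @[n --> \oo] --> (0 : R).
    by rewrite -[X in _ --> X](mulr0 (2 * B)); apply: cvgM => //; exact: cvg_cst.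
  apply/norm_cvg0P; apply: (squeeze_cvgr _ (cvg_cst (0:R)) cb); apply: nearW => n.
  rewrite normr_ge0/=; apply: le_trans (ler_normB _ _) _.
  have B0 : 0 <= B.
    by have := FB 0; rewrite expr0n/= addr0 divr1; exact: le_trans.
  have hb : B / (1 + n.+1%:R ^+ 2) <= B / n.+1%:R.
    have p1 : 0 < 1 + n.+1%:R ^+ 2 :> R by rewrite ltr_pwDl// exprn_ge0.
    rewrite ler_wpM2l// lef_pV2 ?posrE//.
    have : (1 : R) <= n.+1%:R by rewrite ler1n.
    nra.
  have f1 := le_trans (FB n.+1%:R) hb.
  have f2 : `|F (- n.+1%:R)| <= B / n.+1%:R by apply: le_trans hb; rewrite -sqrrN.
  by rewrite -mulrA mulrDl mul1r lerD.
have c2 : \int[mu]_x (\1_(I n) x * f x) @[n --> \oo] --> (0 : R).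
  by under eq_fun do rewrite E.
exact: (cvg_unique _ c1 c2).
Unshelve. all: by end_near. Qed.

End line_integrals.

(** * The Fejer kernel *)

Section fejer_kernel.
Context (R : realType).
Notation mu := (@lebesgue_measure R).
Notation mR := (measurableTypeR R).
Implicit Types (g : R -> R) (x y t l : R).

(** The frequency profile whose cosine transform is the Fejer kernel. *)
Definition ramp t : R := \1_(`[0, 1]%classic : set R) t * (1 - t).

Lemma ramp_out t : ~ `[0, 1]%classic t -> ramp t = 0.
Proof. by move=> h; rewrite /ramp indicE memNset// mul0r. Qed.

Lemma ramp_in t : `[0, 1]%classic t -> ramp t = 1 - t.
Proof. by move=> h; rewrite /ramp indicE mem_set// mul1r. Qed.

Lemma ramp_ge0 t : 0 <= ramp t.
Proof.
have [/[dup] h /=|h] := pselect (`[0, 1]%classic t); last by rewrite ramp_out.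
by rewrite in_itv/= => /andP[_ t1]; rewrite ramp_in// subr_ge0.
Qed.

Lemma ramp_le t : ramp t <= \1_(`[0, 1]%classic : set R) t.
Proof.
rewrite indicE; have [/[dup] h /=|h] := pselect (`[0, 1]%classic t).
  by rewrite in_itv/= => /andP[t0 _]; rewrite ramp_in// mem_set// gerBl.
by rewrite ramp_out// memNset.
Qed.

Lemma measurable_ramp : measurable_fun setT ramp.
Proof.
have mI : measurable_fun setT (\1_(`[0, 1]%classic : set R) : R -> R).
  by apply: measurable_indic; exact: measurable_itv.
by rewrite /ramp; measurability.
Qed.

Definition fejer x : R := \int[mu]_t (ramp t * cos (t * x)).

Let unit_int : mu.-integrable setT (EFin \o (\1_(`[0, 1]%classic : set R) : mR -> R)).
Proof. exact: (@integrable_indic_itv R 0 1 true false). Qed.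

Let ramp_cos_le x t : `|ramp t * cos (t * x)| <= \1_(`[0, 1]%classic : set R) t.
Proof.
rewrite normrM (ger0_norm (ramp_ge0 t)); apply: le_trans (ramp_le t).
by rewrite ler_piMr ?ramp_ge0// cos_max.
Qed.

Lemma fejer_norm_le1 x : `|fejer x| <= 1.
Proof.
have mr := measurable_ramp.
have -> : 1 = \int[mu]_t (\1_(`[0, 1]%classic : set R) t) :> R.
  by rewrite Rintegral_itv1// subr0.
by apply: Rintegral_norm_le => //; measurability.
Qed.

(** An antiderivative of (1 - t) cos(t x) in t is
    (1 - t) sin(t x)/x - cos(t x)/x^2. *)
Lemma fejerE x : x ^+ 2 * fejer x = 1 - cos x.
Proof.
have [->|x0] := eqVneq x 0; first by rewrite expr0n/= mul0r cos0 subrr.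
pose F (t : R) := (1 - t) * (sin (t * x) / x) - cos (t * x) / x ^+ 2.
have dF (t : R) : is_derive t 1 F ((1 - t) * cos (t * x)).
  have ds := is_derive_sinM x t; have dc := is_derive_cosM x t.
  apply: is_derive_eq; rewrite /GRing.scale/=.
  by field.
have -> : fejer x = F 1 - F 0.
  rewrite -(@Rintegral_FTC _ (fun t => (1 - t) * cos (t * x)))//.
    by rewrite -Rintegral_indic; apply: eq_RintegralT => t; rewrite /ramp mulrA.
  move=> t; apply: cvgM; last exact: continuous_cosM.
  by apply: cvgB; [exact: cvg_cst|exact: cvg_id].
by rewrite /F mul0r mul1r sin0 cos0; field.
Qed.

Lemma fejer_ge0 x : 0 <= fejer x.
Proof.
have [->|x0] := eqVneq x 0.
  by apply: Rintegral_ge0 => t _; rewrite mulr0 cos0 mulr1 ramp_ge0.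
have := fejerE x; have : 0 <= 1 - cos x by rewrite subr_ge0 cos_le1.
move=> + e; rewrite -e pmulr_rge0// exprn_even_gt0//=.
Qed.

Lemma fejer_le x : fejer x <= 3 * (1 + x ^+ 2)^-1.
Proof.
have p : 0 < 1 + x ^+ 2 by rewrite ltr_pwDl// sqr_ge0.
rewrite ler_pdivlMr// mulrDr mulr1 [fejer x * x ^+ 2]mulrC fejerE.
have := fejer_norm_le1 x; rewrite ger0_norm ?fejer_ge0//.
have := cos_geN1 x; lra.
Qed.

Lemma fejer_moment_le x : `|x| * fejer x <= 2.
Proof.
have k0 := fejer_ge0 x; have := fejer_norm_le1 x; rewrite ger0_norm// => k1.
have := fejerE x; have := cos_geN1 x; rewrite -(real_normK (num_real x)).
have := normr_ge0 x; have := sqr_ge0 (`|x| - 1); nra.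
Qed.

(** Fubini's theorem gives measurability once the kernel is multiplied by the
    integrable function 1/(1 + x^2), which is then divided out. *)
Lemma measurable_fejer : measurable_fun setT fejer.
Proof.
have mr := measurable_ramp.
have ie := integrable_oneDsqrV R.
have me := integrable_measurable ie.
have mf : measurable_fun (T := (mR * mR)%type) setT
    (fun p => (1 + p.1 ^+ 2)^-1 * (ramp p.2 * cos (p.2 * p.1))).
  have me1 := measurableT_comp me (@measurable_fst _ _ mR mR).
  by apply: measurable_mul; [exact: me1|measurability].
have e0 x : 0 <= (1 + x ^+ 2)^-1 by rewrite invr_ge0 addr_ge0// sqr_ge0.
have fab x t : `|(1 + x ^+ 2)^-1 * (ramp t * cos (t * x))| <=
    (1 + x ^+ 2)^-1 * \1_(`[0, 1]%classic : set R) t.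
  by rewrite normrM (ger0_norm (e0 x)) ler_wpM2l.
have := integrable_measurable (integrable_Rintegral1 mf ie unit_int fab).
have m2 : measurable_fun setT (fun x : mR => 1 + x ^+ 2 : R) by measurability.
move=> /(measurable_mul m2); apply: eq_measurable_fun => x _ /=.
rewrite RintegralZl//.
  by rewrite mulrA mulfV ?mul1r// gt_eqF// ltr_pwDl// sqr_ge0.
by apply: (integrable_dominated _ unit_int (ramp_cos_le x)); measurability.
Qed.

Lemma integrable_fejer : mu.-integrable setT (EFin \o (fejer : mR -> R)).
Proof.
apply: integrable_dominated (integrableZ 3 (integrable_oneDsqrV R)) _.
  exact: measurable_fejer.
by move=> x; rewrite ger0_norm ?fejer_ge0// fejer_le.
Qed.

Definition fejer_mass : R := \int[mu]_x fejer x.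

(** On [0, pi] one has pi^2 fejer x >= 1 - cos x, whose integral is pi. *)
Lemma fejer_mass_gt0 : 0 < fejer_mass.
Proof.
have pi0 := pi_gt0 R.
have mI : measurable_fun setT (\1_(`[0, pi]%classic : set R) : mR -> R).
  by apply: measurable_indic; exact: measurable_itv.
have i1 := @integrable_indic_itv R 0 pi true false.
have : \int[mu]_x (\1_(`[0, pi]%classic : set R) x * (1 - cos (x * 1))) <= pi ^+ 2 * fejer_mass.
  rewrite -RintegralZl//; last exact: integrable_fejer.
  apply: le_Rintegral => //.
  - apply: integrable_dominated (integrableZ 2 i1) _; first by measurability.
    move=> x; have I0 : 0 <= \1_(`[0, pi]%classic : set R) x :> R by rewrite indicE.
    rewrite normrM (ger0_norm I0) mulrC ler_wpM2r//.
    rewrite ger0_norm ?subr_ge0 ?cos_le1//; have := cos_geN1 (x * 1); lra.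
  - by apply: integrableZ; exact: integrable_fejer.
  - move=> x _; rewrite indicE.
    have [/[dup] h /=|h] := pselect (`[0, pi]%classic x); last first.
      by rewrite memNset// mul0r mulr_ge0 ?sqr_ge0 ?fejer_ge0.
    rewrite in_itv/= => /andP[x0 x1]; rewrite mem_set// mul1r mulr1 -fejerE.
    by rewrite ler_wpM2r ?fejer_ge0// lerXn2r// nnegrE// ltW.
rewrite Rintegral_indic Rintegral_onem_cos ?(ltW pi0) ?oner_neq0// mulr1 sinpi mul0r subr0.
move=> /(lt_le_trans pi0); by rewrite pmulr_rgt0// exprn_gt0.
Qed.

End fejer_kernel.

(** * Fejer means as superpositions of waves *)

Section plane_measure.
Context (R : realType).

(** A name of its own for the product, to which the sigma-finite structure is
    attached. *)
Definition plane_measure : set (measurableTypeR R * measurableTypeR R) -> \bar R :=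
  (@lebesgue_measure R \x @lebesgue_measure R)%E.

HB.instance Definition _ := Measure.on plane_measure.

Let plane_measure_sigma_finite : sigma_finite setT plane_measure.
Proof.
have /sigma_finiteP[F [TF ndF Foo]] := sigma_finiteT (@lebesgue_measure R).
exists (fun n => F n `*` F n).
  rewrite -setXTT TF predeqE => -[x y]; split => [[/= [i _ Fx] [j _ Fy]]|[n _ [Fx Fy]]].
    exists (maxn i j) => //; split.
    - by move: x Fx; exact/subsetPset/ndF/leq_maxl.
    - by move: y Fy; exact/subsetPset/ndF/leq_maxr.
  by split; exists n.
move=> n; have [mF Fy] := Foo n; split; first exact: measurableX.
by rewrite /plane_measure product_measure1E// lte_mul_pinfty// ge0_fin_numE.
Qed.

HB.instance Definition _ := Measure_isSigmaFinite.Build _ _ _ plane_measure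
  plane_measure_sigma_finite.

End plane_measure.

Section mollification.
Context (R : realType).
Notation mu := (@lebesgue_measure R).
Notation mR := (measurableTypeR R).
Notation plane := (@plane_measure R).
Implicit Types (g dg : R -> R) (x y t l M : R).

(** One order of decay is enough for g to be integrable and for x g(x) to be
    bounded. *)
Definition decays M g : Prop :=
  continuous g /\ forall x, `|g x| <= M * (1 + x ^+ 2)^-1.

(** Average of g at scale 1/l, not normalised: the kernel has mass [fejer_mass]. *)
Definition mollify l g x : R := \int[mu]_s (g (x + s / l) * fejer s).

(** [fejer_amp], [fejer_freq] and [fejer_phase] present the Fejer mean as a
    superposition over the points (y, t): the wave cos(l t (x - y)) has amplitude
    l g(y) (1 - t), frequency l t and phase l t y. *)
Definition fejer_amp l g (p : mR * mR) : R := l * g p.1 * ramp p.2.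
Definition fejer_freq l (p : mR * mR) : R := l * p.2.
Definition fejer_phase l (p : mR * mR) : R := l * p.2 * p.1.

Lemma oneDsqrV_ge0 x : 0 <= (1 + x ^+ 2)^-1.
Proof. by rewrite invr_ge0 addr_ge0// sqr_ge0. Qed.

Lemma decays_ge0 M g : decays M g -> 0 <= M.
Proof.
by case=> _ /(_ 0); rewrite expr0n/= addr0 invr1 mulr1; exact: le_trans.
Qed.

Lemma decays_le M g x : decays M g -> `|g x| <= M.
Proof.
move=> gd; have M0 := decays_ge0 gd; apply: le_trans (gd.2 x) _.
by rewrite ler_piMr// invf_le1 ?lerDl ?sqr_ge0// ltr_pwDl// sqr_ge0.
Qed.

Lemma decays_moment_le M g x : decays M g -> `|x * g x| <= M.
Proof.
move=> gd; have M0 := decays_ge0 gd; rewrite normrM.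
have p : 0 < 1 + x ^+ 2 by rewrite ltr_pwDl// sqr_ge0.
have := gd.2 x; rewrite ler_pdivlMr// -(real_normK (num_real x)).
have := normr_ge0 x; have := normr_ge0 (g x).
have : 0 <= `|g x| * (`|x| - 1 / 2) ^+ 2 by rewrite mulr_ge0// sqr_ge0.
have : 0 <= `|g x| by [].
nra.
Qed.

Lemma decays_measurable M g : decays M g -> measurable_fun setT g.
Proof. by move=> [cg _]; exact: continuous_measurable_fun. Qed.

Lemma integrable_decays M g : decays M g ->
  mu.-integrable setT (EFin \o (g : mR -> R)).
Proof.
move=> gd; apply: integrable_dominated (integrableZ M (integrable_oneDsqrV R)) _.
  exact: decays_measurable gd.
by move=> x; exact: gd.2.
Qed.

Let unit_int : mu.-integrable setT (EFin \o (\1_(`[0, 1]%classic : set R) : mR -> R)).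
Proof. exact: (@integrable_indic_itv R 0 1 true false). Qed.

Let ramp_norm_le t (c : R) : `|c| <= 1 -> `|ramp t * c| <= \1_(`[0, 1]%classic : set R) t.
Proof.
move=> c1; rewrite normrM (ger0_norm (ramp_ge0 t)); apply: le_trans (ramp_le t).
by rewrite ler_piMr ?ramp_ge0.
Qed.

Let decay_int l M : mu.-integrable setT
  (EFin \o (fun y : mR => l * M * (1 + y ^+ 2)^-1)).
Proof. exact: integrableZ (integrable_oneDsqrV R). Qed.

Lemma integrable_fejer_amp l M g : 0 <= l -> decays M g ->
  plane.-integrable setT (EFin \o fejer_amp l g).
Proof.
move=> l0 gd; have mg := decays_measurable gd; have mr := @measurable_ramp R.
apply: (integrable_prod _ (decay_int l M) unit_int).
  by rewrite /fejer_amp; measurability.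
move=> y t; rewrite /fejer_amp/= normrM; apply: ler_pM => //.
  by rewrite normrM ger0_norm// -mulrA ler_wpM2l//; exact: gd.2.
by rewrite -[ramp t]mulr1 ramp_norm_le// normr1.
Qed.

Lemma fejer_freq_le l g (p : mR * mR) : 0 <= l -> fejer_amp l g p != 0 ->
  `|fejer_freq l p| <= l.
Proof.
move=> l0; rewrite /fejer_amp /fejer_freq => a0.
have [/=|h] := pselect (`[0, 1]%classic p.2); last first.
  by move: a0; rewrite ramp_out// mulr0 eqxx.
rewrite in_itv/= => /andP[t0 t1].
by rewrite normrM !ger0_norm// ler_piMr.
Qed.

Lemma measurable_fejer_freq l : measurable_fun setT (fejer_freq l).
Proof. by rewrite /fejer_freq; measurability. Qed.

Lemma measurable_fejer_phase l : measurable_fun setT (fejer_phase l).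
Proof. by rewrite /fejer_phase; measurability. Qed.

Lemma superpose_fejer l M g x : 0 <= l -> decays M g ->
  superpose plane (fejer_amp l g) (fejer_freq l) (fejer_phase l) x =
  \int[mu]_t \int[mu]_y (l * g y * ramp t * cos (l * t * x - l * t * y)).
Proof.
move=> l0 gd; have mg := decays_measurable gd; have mr := @measurable_ramp R.
pose f (p : mR * mR) : R := l * g p.1 * ramp p.2 * cos (l * p.2 * x - l * p.2 * p.1).
have mf : measurable_fun setT f by rewrite /f; measurability.
have fab y t : `|f (y, t)| <= l * M * (1 + y ^+ 2)^-1 * \1_(`[0, 1]%classic : set R) t.
  rewrite /f/= -[_ * _ * cos _]mulrA normrM; apply: ler_pM => //.
    by rewrite normrM ger0_norm// -mulrA ler_wpM2l//; exact: gd.2.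
  by rewrite ramp_norm_le// cos_max.
have E1 := Rintegral_prod mf (decay_int l M) unit_int fab.
have E2 := Rintegral_fubini mf (decay_int l M) unit_int fab.
exact: etrans E1 E2.
Qed.

Lemma dsuperpose_fejer l M g x : 0 <= l -> decays M g ->
  dsuperpose plane (fejer_amp l g) (fejer_freq l) (fejer_phase l) x =
  \int[mu]_t \int[mu]_y
    (l * g y * ramp t * - (l * t * sin (l * t * x - l * t * y))).
Proof.
move=> l0 gd; have mg := decays_measurable gd; have mr := @measurable_ramp R.
pose f (p : mR * mR) : R :=
  l * g p.1 * ramp p.2 * - (l * p.2 * sin (l * p.2 * x - l * p.2 * p.1)).
have mf : measurable_fun setT f by rewrite /f; measurability.
have fab y t : `|f (y, t)| <= l * M * (1 + y ^+ 2)^-1 * (l * \1_(`[0, 1]%classic : set R) t).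
  rewrite /f/= -[_ * _ * - _]mulrA normrM; apply: ler_pM => //.
    by rewrite normrM ger0_norm// -mulrA ler_wpM2l//; exact: gd.2.
  rewrite (_ : _ * - _ = l * (ramp t * - (t * sin (l * t * x - l * t * y)))); last by ring.
  rewrite normrM ger0_norm// ler_wpM2l//.
  have [/=|h] := pselect (`[0, 1]%classic t); last first.
    by rewrite ramp_out// mul0r normr0 indicE.
  rewrite in_itv/= => /andP[t0 t1]; apply: ramp_norm_le.
  by rewrite normrN normrM mulr_ile1// ?sin_max// ger0_norm.
have E1 := Rintegral_prod mf (decay_int l M) (integrableZ l unit_int) fab.
have E2 := Rintegral_fubini mf (decay_int l M) (integrableZ l unit_int) fab.
exact: etrans E1 E2.
Qed.

(** Integration by parts in y, for each frequency: the derivative of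
    g(y) cos(a (x - y)) has integral 0. *)
Lemma dsuperpose_fejerE l M g dg x : 0 <= l -> decays M g -> decays M dg ->
  (forall y : R, is_derive y 1 g (dg y)) ->
  dsuperpose plane (fejer_amp l g) (fejer_freq l) (fejer_phase l) x =
  superpose plane (fejer_amp l dg) (fejer_freq l) (fejer_phase l) x.
Proof.
move=> l0 gd dgd dgE; rewrite (dsuperpose_fejer x l0 gd) (superpose_fejer x l0 dgd).
apply: eq_RintegralT => t.
have [cg gM] := gd; have [cdg dgM] := dgd.
pose a := l * t.
have cco (h : R -> R) : continuous h -> continuous (fun y : R => h (a * x - a * y)).
  move=> ch y; apply: (@continuous_comp R R R (fun y => a * x - a * y) h); last exact: ch.
  apply: cvgB; first exact: cvg_cst.
  by apply: cvgM; [exact: cvg_cst|exact: cvg_id].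
have dcos (y : R) : is_derive y 1 (fun y => cos (a * x - a * y)) (a * sin (a * x - a * y)).
  have dl : is_derive y 1 (fun y : R => a * x - a * y) (- a).
    by apply: is_derive_eq; rewrite /GRing.scale/=; ring.
  have := @is_derive1_comp _ cos (fun y => a * x - a * y) y _ _
    (is_derive_cos (a * x - a * y)) dl.
  by rewrite mulrNN [sin _ * a]mulrC.
pose F y := g y * cos (a * x - a * y).
pose f y := dg y * cos (a * x - a * y) - g y * - (a * sin (a * x - a * y)).
have dF (y : R) : is_derive y 1 F (f y).
  have dgy := dgE y; have dcy := dcos y.
  by apply: is_derive_eq; rewrite /f /GRing.scale/=; ring.
have cc := cco _ (@continuous_cos R); have cs := cco _ (@continuous_sin R).
have ic : mu.-integrable setT (EFin \o ((fun y => dg y * cos (a * x - a * y)) : mR -> R)).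
  apply: integrable_dominated (decay_int 1 M) _.
    by apply: continuous_measurable_fun => y; apply: cvgM; [exact: cdg|exact: cc].
  by move=> y; rewrite normrM mul1r (le_trans _ (dgM y))// ler_piMr// cos_max.
have is' : mu.-integrable setT
    (EFin \o ((fun y => g y * - (a * sin (a * x - a * y))) : mR -> R)).
  apply: integrable_dominated (decay_int `|a| M) _.
    apply: continuous_measurable_fun => y; apply: cvgM; first exact: cg.
    by apply: cvgN; apply: cvgM; [exact: cvg_cst|exact: cs].
  move=> y; rewrite normrM normrN normrM mulrCA -mulrA ler_wpM2l//.
  by rewrite (le_trans _ (gM y))// ler_piMr// sin_max.
have : \int[mu]_y f y = 0.
  apply: (@integral_derivative_eq0 _ f F M) => //.
  - move=> y; apply: cvgB; first by apply: cvgM; [exact: cdg|exact: cc].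
    apply: cvgM; first exact: cg.
    by apply: cvgN; apply: cvgM; [exact: cvg_cst|exact: cs].
  - exact: integrableB_real.
  - by move=> y; rewrite /F normrM (le_trans _ (gM y))// ler_piMr// cos_max.
rewrite RintegralB// => /eqP; rewrite subr_eq0 => /eqP E.
transitivity (l * ramp t * \int[mu]_y (g y * - (a * sin (a * x - a * y)))).
  by rewrite -RintegralZl//; apply: eq_RintegralT => y; rewrite /a; ring.
by rewrite -E -RintegralZl//; apply: eq_RintegralT => y; rewrite /a; ring.
Qed.

(** Substitute y = x + s/l at fixed frequency, then integrate over the frequency:
    the cosines add up to the kernel. *)
Lemma mollifyE l M g x : 0 < l -> decays M g ->
  superpose plane (fejer_amp l g) (fejer_freq l) (fejer_phase l) x = mollify l g x.
Proof.
move=> l0 gd; rewrite (superpose_fejer x (ltW l0) gd); have [cg gM] := gd.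
have mg := decays_measurable gd; have mr := @measurable_ramp R.
have ig' := integrable_comp_affine x l0 cg (integrable_decays gd).
have mg' : measurable_fun setT (fun s : mR => g (x + s / l)) by measurability.
pose f (p : mR * mR) : R := g (x + p.1 / l) * (ramp p.2 * cos (p.2 * p.1)).
have mf : measurable_fun setT f.
  have m1 := measurableT_comp mg' (@measurable_fst _ _ mR mR).
  by apply: measurable_mul; [exact: m1|measurability].
have fab s t : `|f (s, t)| <= `|g (x + s / l)| * \1_(`[0, 1]%classic : set R) t.
  by rewrite /f/= normrM ler_wpM2l// ramp_norm_le// cos_max.
have ig'' : mu.-integrable setT (EFin \o (fun s : mR => `|g (x + s / l)|)).
  exact: integrable_abse ig'.
have E := Rintegral_fubini mf ig'' unit_int fab.
transitivity (\int[mu]_t \int[mu]_s f (s, t)).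
  apply: eq_RintegralT => t.
  pose G y := l * g y * ramp t * cos (l * t * x - l * t * y).
  have cG : continuous G.
    move=> y; apply: cvgM.
      apply: cvgM; last exact: cvg_cst.
      by apply: cvgM; [exact: cvg_cst|exact: cg].
    apply: (@continuous_comp R R R (fun y => l * t * x - l * t * y) cos); last exact: continuous_cos.
    apply: cvgB; first exact: cvg_cst.
    by apply: cvgM; [exact: cvg_cst|exact: cvg_id].
  have iG : mu.-integrable setT (EFin \o (G : mR -> R)).
    apply: integrable_dominated (decay_int (l * ramp t) M) _.
      exact: continuous_measurable_fun.
    move=> y; rewrite /G (_ : _ * _ * _ * _ = l * ramp t * (g y * cos (l * t * x - l * t * y))); last by ring.
    have lr : 0 <= l * ramp t by rewrite mulr_ge0 ?ramp_ge0// ltW.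
    rewrite normrM (ger0_norm lr) -[leRHS]mulrA ler_wpM2l//.
    by rewrite normrM (le_trans _ (gM y))// ler_piMr// cos_max.
  rewrite (Rintegral_affine x l0 cG iG) -RintegralZl//; last exact: integrable_comp_affine.
  apply: eq_RintegralT => s; rewrite /G /f/=.
  have -> : l * t * x - l * t * (x + s / l) = - (t * s) by field; rewrite gt_eqF.
  by rewrite cosN; field; rewrite gt_eqF.
rewrite -E; apply: eq_RintegralT => s; rewrite /f/= RintegralZl//.
apply: (integrable_dominated _ unit_int); first by measurability.
by move=> t; rewrite ramp_norm_le// cos_max.
Qed.

Lemma measurable_mollify_term l M g x : decays M g ->
  measurable_fun setT (fun s : mR => g (x + s / l) * fejer s).
Proof.
move=> gd; have mg := decays_measurable gd; have mk := @measurable_fejer R.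
by measurability.
Qed.

Lemma integrable_mollify_term l M g x : decays M g ->
  mu.-integrable setT (EFin \o (fun s : mR => g (x + s / l) * fejer s)).
Proof.
move=> gd; apply: integrable_dominated (integrableZ M (integrable_fejer R)) _.
  exact: measurable_mollify_term gd.
move=> s; rewrite normrM (ger0_norm (fejer_ge0 s)) ler_wpM2r ?fejer_ge0//.
exact: decays_le gd.
Qed.

Lemma mollify_le l M g x : decays M g -> `|mollify l g x| <= M * fejer_mass R.
Proof.
move=> gd; rewrite /fejer_mass -RintegralZl//; last exact: integrable_fejer.
apply: Rintegral_norm_le.
- exact: measurable_mollify_term gd.
- by apply: integrableZ; exact: integrable_fejer.
- move=> s; rewrite normrM (ger0_norm (fejer_ge0 s)) ler_wpM2r ?fejer_ge0//.
  exact: decays_le gd.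
Qed.

(** Write x = (x + s/l) - s/l.  The first term is controlled by the bound on
    y g(y); for the second, |s| fejer s <= 2 and substituting back yields the
    integral of |g|, whatever l is. *)
Lemma mollify_moment_le l M g x : 0 < l -> decays M g ->
  `|x * mollify l g x| <= M * fejer_mass R + 2 * \int[mu]_y `|g y|.
Proof.
move=> l0 gd; have [cg _] := gd; have ig := integrable_decays gd.
have cN : continuous (fun y : R => `|g y|) by move=> y; apply: cvg_norm; exact: cg.
have iN : mu.-integrable setT (EFin \o ((fun y => `|g y|) : mR -> R)) by exact: integrable_abse ig.
have iN' := integrable_comp_affine x l0 cN iN.
have iK := integrable_fejer R.
rewrite /mollify -RintegralZl//; last exact: integrable_mollify_term gd.
rewrite (Rintegral_affine x l0 cN iN) mulrA -!RintegralZl//.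
rewrite -RintegralD//; [|exact: integrableZ|exact: integrableZ].
apply: Rintegral_norm_le.
- apply: measurable_mul; first exact: measurable_cst_real.
  exact: measurable_mollify_term gd.
- by apply: integrableD_real; exact: integrableZ.
- move=> s; have k0 := fejer_ge0 s.
  set y := x + s / l.
  have -> : x * (g y * fejer s) = (y * g y) * fejer s - l^-1 * (g y * (s * fejer s)).
    by rewrite /y; field; rewrite gt_eqF.
  apply: le_trans (ler_normB _ _) _; apply: lerD.
    by rewrite normrM (ger0_norm k0) ler_wpM2r// (decays_moment_le _ gd).
  have li : 0 <= l^-1 by rewrite invr_ge0 ltW.
  rewrite normrM (ger0_norm li) [2 * _]mulrC -mulrA ler_wpM2l//.
  rewrite normrM [leRHS]mulrC ler_wpM2l// normrM (ger0_norm k0).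
  exact: fejer_moment_le.
Qed.

Lemma mollify_lipschitz l M g x y : decays M g ->
  (forall u v, `|g u - g v| <= M * `|u - v|) ->
  `|mollify l g x - mollify l g y| <= M * fejer_mass R * `|x - y|.
Proof.
move=> gd gl; have iK := integrable_fejer R.
rewrite /mollify -RintegralB//; [|exact: integrable_mollify_term gd|
  exact: integrable_mollify_term gd].
rewrite mulrAC -RintegralZl//; apply: Rintegral_norm_le.
- apply: measurable_add; first exact: measurable_mollify_term gd.
  by apply: measurable_opp; exact: measurable_mollify_term gd.
- exact: integrableZ.
- move=> s; rewrite -mulrBl normrM (ger0_norm (fejer_ge0 s)) ler_wpM2r ?fejer_ge0//.
  apply: le_trans (gl _ _) _.
  by have -> : x + s / l - (y + s / l) = x - y by ring.
Qed.

Lemma mollify_cvg M g x : decays M g ->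
  mollify n.+1%:R g x @[n --> \oo] --> fejer_mass R * g x.
Proof.
move=> gd; have [cg _] := gd; have iK := integrable_fejer R.
rewrite mulrC -RintegralZl//.
apply: (@Rintegral_dominated_cvg _ _ _ mu _ _ (fun s : mR => M * fejer s)).
- by move=> n; exact: measurable_mollify_term gd.
- by apply: measurable_mul; [exact: measurable_cst_real|exact: measurable_fejer].
- exact: integrableZ.
- move=> n s; rewrite normrM (ger0_norm (fejer_ge0 s)) ler_wpM2r ?fejer_ge0//.
  exact: decays_le gd.
- move=> s; apply: cvgM; last exact: cvg_cst.
  apply: (@continuous_cvg _ _ _ _ _ _ g); first exact: cg.
  have cx : x + s / n.+1%:R @[n --> \oo] --> x + s * 0.
    apply: cvgD; first exact: cvg_cst.
    by apply: cvgM; [exact: cvg_cst|exact: cvg_harmonic].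
  by rewrite mulr0 addr0 in cx.
Qed.

End mollification.

(** * The identity for real test functions *)

Section real_stein_identity.
Context (R : realType) (nu : {sigma_finite_measure set (measurableTypeR R) -> \bar R}).
Hypothesis weight_int : nu.-integrable setT (EFin \o @levy_weight R).
Context (beta sigma : R).
Context (d : measure_display) (T : measurableType d) (P : probability T R)
  (X : T -> R).
Hypothesis mX : measurable_fun setT X.
Hypothesis char_cos : forall z, \int[P]_t cos (z * X t) =
  expR (levy_re nu sigma z) * cos (levy_im nu beta z).
Hypothesis char_sin : forall z, \int[P]_t sin (z * X t) =
  expR (levy_re nu sigma z) * sin (levy_im nu beta z).
Hypothesis dchar_cos : forall z : R, derivable (fun z : R => \int[P]_t cos (z * X t)) z 1.
Hypothesis dchar_sin : forall z : R, derivable (fun z : R => \int[P]_t sin (z * X t)) z 1.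
Context (g dg : R -> R) (M : R).
Hypothesis gM : decays M g.
Hypothesis dgM : decays M dg.
Hypothesis dgE : forall x : R, is_derive x 1 g (dg x).

Lemma derivable_lipschitz x y : `|g x - g y| <= M * `|x - y|.
Proof.
wlog xy : x y / x < y.
  move=> H; have [xy|xy|->] := ltgtP x y; first exact: H.
    by rewrite distrC [`|x - y|]distrC; exact: H.
  by rewrite !subrr normr0 mulr0.
rewrite distrC [`|x - y|]distrC.
have [c _ ->] := @MVT R g dg x y xy (fun z _ => dgE z) (continuous_subspaceT gM.1).
by rewrite normrM ler_wpM2r// (decays_le _ dgM).
Qed.

Lemma decays_tame : tame M g.
Proof.
split=> [x|x|]; [exact: decays_le gM|exact: decays_moment_le gM|].
exact: derivable_lipschitz.
Qed.

(** By [mollifyE] and [dsuperpose_fejerE] the identity holds for the Fejer means;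
    the uniform tame bounds allow the passage to the limit, where the operator is
    multiplied by [fejer_mass]. *)
Lemma stein_identity_real :
  P.-integrable setT (EFin \o (fun t => stein_step nu beta sigma id g dg (X t))) /\
  \int[P]_t stein_step nu beta sigma id g dg (X t) = 0.
Proof.
have [K tail] := far_jump_tail weight_int char_cos char_sin dchar_cos dchar_sin.
have osc := levy_osc_little_o weight_int char_cos char_sin dchar_cos dchar_sin.
pose c := fejer_mass R; have c0 : 0 < c by exact: fejer_mass_gt0.
pose I : R := \int[@lebesgue_measure R]_y `|g y|.
have I0 : 0 <= I by exact: Rintegral_ge0.
(* the common tame bound of all the Fejer means, from [mollify_moment_le] *)
pose M' := M * c + 2 * I.
have McM' : M * c <= M' by rewrite /M' lerDl mulr_ge0.
pose l n : R := n.+1%:R.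
have l0 n : 0 < l n by exact: ltr0Sn.
pose G n := mollify (l n) g; pose dG n := mollify (l n) dg.
have tG n : tame M' (G n).
  split=> [x|x|x y].
  - exact: le_trans (mollify_le _ _ gM) McM'.
  - exact: (mollify_moment_le x (l0 n) gM).
  - apply: le_trans (mollify_lipschitz (l n) x y gM derivable_lipschitz) _.
    by rewrite ler_wpM2r.
have dGM n x : `|dG n x| <= M' by exact: le_trans (mollify_le _ _ dgM) McM'.
have zero n : measurable_fun setT (fun t => stein_step nu beta sigma id (G n) (dG n) (X t)) /\
    \int[P]_t stein_step nu beta sigma id (G n) (dG n) (X t) = 0.
  have GE : G n = superpose (@plane_measure R) (fejer_amp (l n) g) (fejer_freq (l n))
      (fejer_phase (l n)).
    by apply/funext => x; rewrite (mollifyE x (l0 n) gM).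
  have dGE : dG n = dsuperpose (@plane_measure R) (fejer_amp (l n) g) (fejer_freq (l n))
      (fejer_phase (l n)).
    apply/funext => x; rewrite (dsuperpose_fejerE x (ltW (l0 n)) gM dgM dgE).
    by rewrite (mollifyE x (l0 n) dgM).
  have tGn := tG n; have dGn := dGM n; rewrite GE in tGn; rewrite dGE in dGn.
  rewrite GE dGE.
  apply: (@stein_superpose_eq0 _ nu weight_int beta sigma _ _ P X mX char_cos char_sin
    osc _ _ _ _ _ _ (l n) _ _ _ _ _ K M') => //.
  - exact: integrable_fejer_amp (ltW (l0 n)) gM.
  - exact: measurable_fejer_freq.
  - exact: measurable_fejer_phase.
  - by move=> p; exact: fejer_freq_le (ltW (l0 n)).
pose cg x := c * g x; pose cdg x := c * dg x.
have [tg0 tg1 tg2] := decays_tame.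
have tcg : tame M' cg.
  split=> [x|x|x y].
  - rewrite normrM gtr0_norm// mulrC (le_trans _ McM')//.
    by rewrite ler_wpM2r// ltW.
  - rewrite mulrCA normrM gtr0_norm// mulrC (le_trans _ McM')//.
    by rewrite ler_wpM2r// ltW.
  - rewrite -mulrBr normrM gtr0_norm// (@le_trans _ _ (c * (M * `|x - y|)))//.
      by rewrite ler_wpM2l// ltW.
    by rewrite mulrA [c * M]mulrC ler_wpM2r.
have lim t : stein_step nu beta sigma id (G n) (dG n) (X t) @[n --> \oo] -->
    stein_step nu beta sigma id cg cdg (X t).
  apply: (@stein_step_cvg _ nu weight_int beta sigma M' (fun=> id) id G dG) => //.
  - by move=> n; exact: frequency_step_id.
  - exact: frequency_step_id.
  - by move=> u; exact: cvg_cst.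
  - by move=> y; exact: mollify_cvg gM.
  - by move=> y; exact: mollify_cvg dgM.
have mlim : measurable_fun setT (fun t => stein_step nu beta sigma id cg cdg (X t)).
  apply: (measurable_fun_cvg (h := fun n t => stein_step nu beta sigma id (G n) (dG n) (X t))) => //.
  by move=> n; have [] := zero n.
have E0 : \int[P]_t stein_step nu beta sigma id cg cdg (X t) = 0.
  pose B := M' * (1 + `|beta| + sigma ^+ 2 + (3 * levy_mass nu + K)).
  have h : \int[P]_t stein_step nu beta sigma id (G n) (dG n) (X t) @[n --> \oo] -->
      \int[P]_t stein_step nu beta sigma id cg cdg (X t).
    apply: (@Rintegral_dominated_cvg _ _ _ P _ _ (fun=> B)) => //.
    - by move=> n; have [] := zero n.
    - exact: finite_measure_integrable_cst.
    - by move=> n t; apply: stein_step_le => //; exact: frequency_step_id.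
  have z0 : \int[P]_t stein_step nu beta sigma id (G n) (dG n) (X t) @[n --> \oo] --> (0 : R).
    by under eq_fun do rewrite (zero _).2; exact: cvg_cst.
  exact: (cvg_unique _ h z0).
have scale x : stein_step nu beta sigma id cg cdg x =
    c * stein_step nu beta sigma id g dg x.
  rewrite /stein_step /cg /cdg (_ : jump_int nu id _ x = c * jump_int nu id g x); first by ring.
  rewrite -RintegralZl//.
    by apply: eq_RintegralT => u; rewrite /jump_term; ring.
  exact: (integrable_jump_term weight_int x (@frequency_step_id R) decays_tame).
have unscale t : stein_step nu beta sigma id g dg (X t) =
    c^-1 * stein_step nu beta sigma id cg cdg (X t).
  by rewrite scale mulKf// gt_eqF.
have int_stein : P.-integrable setT
    (EFin \o (fun t => stein_step nu beta sigma id g dg (X t))).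
  apply: (@integrable_dominated _ _ _ _ _
      (fun=> M * (1 + `|beta| + sigma ^+ 2 + (3 * levy_mass nu + K)))).
  - under eq_fun do rewrite unscale.
    by apply: measurable_mul => //; exact: measurable_cst_real.
  - exact: finite_measure_integrable_cst.
  - move=> t; apply: stein_step_le => //; first exact: frequency_step_id.
    by move=> y; exact: decays_le dgM.
split; first exact: int_stein.
apply: (mulfI (lt0r_neq0 c0)); rewrite mulr0 -E0.
rewrite -(RintegralZl _ measurableT int_stein).
by apply: eq_RintegralT => t; rewrite scale.
Qed.

End real_stein_identity.

(** * Levy measures are sigma-finite *)

Section levy_measure_facts.
Context (R : realType) (nu : {measure set (measurableTypeR R) -> \bar R}).
Hypothesis nu_levy : levy_measure nu.

Lemma levy_weight_integrable : nu.-integrable setT (EFin \o @levy_weight R).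
Proof.
have mw := @measurable_levy_weight R.
apply/integrableP; split; first exact/measurable_EFinP.
case: nu_levy => _; apply: le_lt_trans; apply: ge0_le_integral => //.
- by apply: measurableT_comp => //; exact/measurable_EFinP.
- exact/measurable_EFinP.
- by move=> u _; rewrite gee0_abs// lee_fin levy_weight_ge0.
Qed.

(** The measure of the set where the weight is at least 1/(n+1) is finite by
    Markov's inequality, and only the null set {0} is left out. *)
Lemma levy_sigma_finite : sigma_finite setT nu.
Proof.
pose F n : set (measurableTypeR R) :=
  [set 0] `|` [set u | (n.+1%:R : R)^-1 <= levy_weight u].
have mG n : measurable [set u : measurableTypeR R | (n.+1%:R : R)^-1 <= levy_weight u].
  have := @measurable_levy_weight R.
  move=> /(_ measurableT _ (measurable_itv `[(n.+1%:R : R)^-1, +oo[)).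
  rewrite setTI; congr (measurable _); apply/seteqP; split => u /=;
    by rewrite in_itv/= andbT.
exists F.
  apply/seteqP; split => // u _.
  have [->|u0] := eqVneq u 0; first by exists 0%N => //; left.
  have w0 : 0 < levy_weight u by rewrite lt_min ltr01/= exprn_even_gt0.
  have [n hn] := ltr_add_invr w0; exists n => //; right.
  by rewrite /= ltW// -[X in X < _]add0r.
move=> n; split; first by apply: measurableU => //; exact: measurable_set1.
have m0 : measurable ([set 0] : set (measurableTypeR R)) by exact: measurable_set1.
apply: (le_lt_trans (measureU2 nu m0 (mG n))).
have nu0 := nu_levy.1; rewrite [X in (X + _)%E]nu0 add0e.
rewrite -[X in (nu X < _)%E]setIT -integral_indic//.
have := integrableZ n.+1%:R levy_weight_integrable => /integrableP[mW].
apply: le_lt_trans; apply: ge0_le_integral => //.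
- by apply/measurable_EFinP; exact: measurable_indic.
- exact: measurableT_comp.
- move=> u _; rewrite /= lee_fin (le_trans _ (ler_norm _))// indicE.
  have [|_] := boolP (u \in _); last by rewrite mulr_ge0// levy_weight_ge0.
  by rewrite inE /= -(ler_pM2l (ltr0Sn R n)) mulfV// gt_eqF.
Qed.

(** The hypothesis is an argument so that the sigma-finite structure, which depends
    on it, can be attached to the result. *)
Definition levy_sfm of levy_measure nu : set (measurableTypeR R) -> \bar R := nu.
HB.instance Definition _ := Measure.on (levy_sfm nu_levy).
HB.instance Definition _ := Measure_isSigmaFinite.Build _ _ _ (levy_sfm nu_levy)
  levy_sigma_finite.

End levy_measure_facts.

(** * Real and imaginary parts of the statement *)

Section complex_components.
Context (R : realType).
Implicit Types (x y : R) (z : R[i]).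

Lemma Re_le_normc z : `|complex.Re z| <= ComplexField.Normc.normc z.
Proof.
case: z => a b /=; rewrite -sqrtr_sqr ler_sqrt ?lerDl ?sqr_ge0//.
by rewrite addr_ge0// sqr_ge0.
Qed.

Lemma Im_le_normc z : `|complex.Im z| <= ComplexField.Normc.normc z.
Proof.
case: z => a b /=; rewrite -sqrtr_sqr ler_sqrt ?lerDr ?sqr_ge0//.
by rewrite addr_ge0// sqr_ge0.
Qed.

Lemma ReM_real x z : complex.Re (x%:C * z) = x * complex.Re z.
Proof. by case: z => a b; simpc. Qed.

Lemma ImM_real x z : complex.Im (x%:C * z) = x * complex.Im z.
Proof. by case: z => a b; simpc. Qed.

Lemma Re_cexp_i x : complex.Re (cexp ('i%C * x%:C)) = cos x.
Proof. by rewrite /cexp; simpc; rewrite /= expR0 mul1r. Qed.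

Lemma Im_cexp_i x : complex.Im (cexp ('i%C * x%:C)) = sin x.
Proof. by rewrite /cexp; simpc; rewrite /= expR0 mul1r. Qed.

Lemma ReD z1 z2 : complex.Re (z1 + z2) = complex.Re z1 + complex.Re z2.
Proof. by case: z1 z2 => a b [e f]. Qed.

Lemma ImD z1 z2 : complex.Im (z1 + z2) = complex.Im z1 + complex.Im z2.
Proof. by case: z1 z2 => a b [e f]. Qed.

Lemma ReB z1 z2 : complex.Re (z1 - z2) = complex.Re z1 - complex.Re z2.
Proof. by case: z1 z2 => a b [e f]. Qed.

Lemma ImB z1 z2 : complex.Im (z1 - z2) = complex.Im z1 - complex.Im z2.
Proof. by case: z1 z2 => a b [e f]. Qed.

Lemma realCX x n : x%:C ^+ n = (x ^+ n)%:C.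
Proof. by rewrite -rmorphXn. Qed.

End complex_components.

Section exponent_components.
Context (R : realType) (nu : {measure set (measurableTypeR R) -> \bar R}).

Let jump_exponent z u : R[i] := cexp ('i%C * (u * z)%:C) - 1
  - 'i%C * (u * z * \1_(@small_jump R) u)%:C.

Lemma Re_levy_exponent beta sigma z :
  complex.Re (levy_exponent beta sigma nu z) = levy_re nu sigma z.
Proof.
have jE u : complex.Re (jump_exponent z u) = cos (u * z) - 1.
  by rewrite !ReB Re_cexp_i /=; ring.
rewrite /levy_exponent -/(jump_exponent z) ReD ReB.
rewrite [complex.Re (cintegral _ _)](eq_RintegralT nu jE) /levy_re /=.
by ring.
Qed.

Lemma Im_levy_exponent beta sigma z :
  complex.Im (levy_exponent beta sigma nu z) = levy_im nu beta z.
Proof.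
have jE u : complex.Im (jump_exponent z u) =
    sin (u * z) - u * z * \1_(@small_jump R) u.
  by rewrite !ImB Im_cexp_i /=; ring.
rewrite /levy_exponent -/(jump_exponent z) ImD ImB.
rewrite [complex.Im (cintegral _ _)](eq_RintegralT nu jE) /levy_im /=.
by ring.
Qed.

End exponent_components.

Section char_components.
Context (R : realType) (d : measure_display) (T : measurableType d)
  (P : probability T R) (X : {RV P >-> R}) (beta sigma : R)
  (nu : {measure set (measurableTypeR R) -> \bar R}).

Lemma Re_char_fun z : complex.Re (char_fun X z) = \int[P]_t cos (z * X t).
Proof. by apply: eq_RintegralT => t; rewrite Re_cexp_i. Qed.

Lemma Im_char_fun z : complex.Im (char_fun X z) = \int[P]_t sin (z * X t).
Proof. by apply: eq_RintegralT => t; rewrite Im_cexp_i. Qed.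

Hypothesis X_idd : IDD X beta sigma nu.

Lemma IDD_cos z : \int[P]_t cos (z * X t) =
  expR (levy_re nu sigma z) * cos (levy_im nu beta z).
Proof.
rewrite -Re_char_fun X_idd /cexp Re_levy_exponent Im_levy_exponent.
by rewrite ReM_real.
Qed.

Lemma IDD_sin z : \int[P]_t sin (z * X t) =
  expR (levy_re nu sigma z) * sin (levy_im nu beta z).
Proof.
rewrite -Im_char_fun X_idd /cexp Re_levy_exponent Im_levy_exponent.
by rewrite ImM_real.
Qed.

End char_components.

Section schwartz_components.
Context (R : realType).

Lemma decaysP (f : R -> R) (M0 M2 : R) : continuous f -> (forall x, `|f x| <= M0) ->
  (forall x, `|x ^+ 2 * f x| <= M2) -> decays (M0 + M2) f.
Proof.
move=> cf f0 f2; split=> // x.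
rewrite ler_pdivlMr; last by rewrite ltr_pwDl// sqr_ge0.
have := f2 x; rewrite normrM (ger0_norm (sqr_ge0 x)); have := f0 x; lra.
Qed.

Lemma decaysW M M' (f : R -> R) : M <= M' -> decays M f -> decays M' f.
Proof.
move=> MM' [cf fM]; split=> // x; apply: le_trans (fM x) _.
by rewrite ler_wpM2r// oneDsqrV_ge0.
Qed.

(** The function c stands for the real or the imaginary part.  The decay bound is
    the sum of the Schwartz bounds of weights 1 and x^2, for g and its derivative. *)
Lemma schwartz_component (c : R[i] -> R) (g : R -> R[i]) : schwartz g ->
  (forall z, `|c z| <= ComplexField.Normc.normc z) ->
  (forall x z, c (x%:C * z) = x * c z) ->
  (forall n (x : R), derivable (fun t => c (iter n (@cderive1 R) g t)) x 1) ->
  (forall x, c (cderive1 g x) = derive1 (fun t => c (g t)) x) ->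
  exists M, [/\ decays M (fun x => c (g x)),
    decays M (derive1 (fun x => c (g x))) &
    forall x : R, is_derive x 1 (fun t => c (g t)) (derive1 (fun t => c (g t)) x)].
Proof.
move=> [_ gb] cn cM dc cd.
have cc n : continuous (fun t => c (iter n (@cderive1 R) g t)).
  by move=> x; exact/differentiable_continuous/derivable1_diffP/dc.
have bound n : exists M, decays M (fun t => c (iter n (@cderive1 R) g t)).
  have [M0 h0] := gb 0%N n; have [M2 h2] := gb 2%N n.
  exists (M0 + M2); apply: decaysP => // x.
    by apply: le_trans (cn _) _; have := h0 x; rewrite expr0 mul1r.
  rewrite -cM; apply: le_trans (cn _) _.
  by have := h2 x; rewrite realCX.
have [Ma ha] := bound 0%N; have [Mb hb] := bound 1%N.
exists (Num.max Ma Mb); split.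
- by apply: decaysW ha; rewrite le_max lexx.
- rewrite (_ : derive1 _ = fun x => c (cderive1 g x)); last first.
    by apply/funext => x; rewrite cd.
  by apply: decaysW hb; rewrite le_max lexx orbT.
- by move=> x; rewrite derive1E; apply/derivableP; exact: (@dc 0%N).
Qed.

End schwartz_components.

Theorem theorem3p1 (R : realType) (d : measure_display) (T : measurableType d)
    (P : probability T R) (X : {RV P >-> R}) (beta sigma : R)
    (nu : {measure set (measurableTypeR R) -> \bar R})
    (sigma_ge0 : 0 <= sigma) (nu_levy : levy_measure nu)
    (X_idd : IDD X beta sigma nu)
    (phi_diff : forall z : R, cderivable (char_fun X) z)
    (g : R -> R[i]) (g_schwartz : schwartz g) :
  (forall w : T, cintegrable nu (jump_integrand g (X w))) /\
  cintegrable P (fun w => stein_op beta sigma nu g (X w)) /\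
  cintegral P (fun w => stein_op beta sigma nu g (X w)) = 0.
Proof.
have weight_int := levy_weight_integrable nu_levy.
pose nu' : {sigma_finite_measure set (measurableTypeR R) -> \bar R} :=
  levy_sfm nu_levy.
have mX : measurable_fun setT (X : T -> R) by exact: measurable_funPT.
have dcos (z : R) : derivable (fun z : R => \int[P]_t cos (z * X t)) z 1.
  have [+ _] := phi_diff z.
  by rewrite (_ : (fun t => _) = (fun z : R => \int[P]_t cos (z * X t)))//;
    apply/funext => t; rewrite Re_char_fun.
have dsin (z : R) : derivable (fun z : R => \int[P]_t sin (z * X t)) z 1.
  have [_ +] := phi_diff z.
  by rewrite (_ : (fun t => _) = (fun z : R => \int[P]_t sin (z * X t)))//;
    apply/funext => t; rewrite Im_char_fun.
have [Mr [gr dgr dgrE]] := @schwartz_component R (@complex.Re R) g g_schwartz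
  (@Re_le_normc R) (@ReM_real R) (fun n x => (g_schwartz.1 n x).1) (fun=> erefl).
have [Mi [gi dgi dgiE]] := @schwartz_component R (@complex.Im R) g g_schwartz
  (@Im_le_normc R) (@ImM_real R) (fun n x => (g_schwartz.1 n x).2) (fun=> erefl).
have [ir er] := @stein_identity_real R nu' weight_int beta sigma d T P X mX
  (IDD_cos X_idd) (IDD_sin X_idd) dcos dsin _ _ Mr gr dgr dgrE.
have [ii ei] := @stein_identity_real R nu' weight_int beta sigma d T P X mX
  (IDD_cos X_idd) (IDD_sin X_idd) dcos dsin _ _ Mi gi dgi dgiE.
have jr x u : complex.Re (jump_integrand g x u) =
    jump_term id (fun y => complex.Re (g y)) x u.
  rewrite /jump_integrand ReM_real ReB [g x * _]mulrC ReM_real /jump_term /=; ring.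
have ji x u : complex.Im (jump_integrand g x u) =
    jump_term id (fun y => complex.Im (g y)) x u.
  rewrite /jump_integrand ImM_real ImB [g x * _]mulrC ImM_real /jump_term /=; ring.
have sr x : complex.Re (stein_op beta sigma nu g x) =
    stein_step nu' beta sigma id (fun y => complex.Re (g y))
      (derive1 (fun y => complex.Re (g y))) x.
  rewrite /stein_op !ReB !ReM_real /=.
  rewrite (eq_RintegralT nu (jr x)) /stein_step /jump_int /=; ring.
have si x : complex.Im (stein_op beta sigma nu g x) =
    stein_step nu' beta sigma id (fun y => complex.Im (g y))
      (derive1 (fun y => complex.Im (g y))) x.
  rewrite /stein_op !ImB !ImM_real /=.
  rewrite (eq_RintegralT nu (ji x)) /stein_step /jump_int /=; ring.
split=> [w|].
  split.
  - under eq_fun do rewrite jr.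
    exact: (@integrable_jump_term _ nu' weight_int _ _ _ (X w) (@frequency_step_id R)
      (decays_tame gr dgr dgrE)).
  - under eq_fun do rewrite ji.
    exact: (@integrable_jump_term _ nu' weight_int _ _ _ (X w) (@frequency_step_id R)
      (decays_tame gi dgi dgiE)).
split.
  split.
  - by under eq_fun do rewrite sr.
  - by under eq_fun do rewrite si.
rewrite /cintegral; under eq_RintegralT do rewrite sr.
by under [X in _ +i* X]eq_RintegralT do rewrite si; rewrite er ei.
Qed.
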